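(* Let $F$ be an infinite field with $\operatorname{char} F = 0$ or $\operatorname{char} F \geq n$. Then every $T_{\mathbb{Z}_n}$-ideal $J$ of $\mathcal{L}_{\mathbb{Z}_n}$ with $I \subseteq J$ is finitely generated as a $T_{\mathbb{Z}_n}$-ideal. In other words, the ideal $I$ of $\mathbb{Z}_n$-graded identities of $UT_n(F)^{(-)}$ with its canonical grading has the Specht property.
   Context: $UT_n(F)^{(-)}$ is the Lie algebra of $n\times n$ upper triangular matrices over $F$ with bracket $[a,b]=ab-ba$. Its canonical $\mathbb{Z}_n$-grading is $UT_n(F)^{(-)}=\bigoplus_{k=0}^{n-1}L_k$, where $L_k$ is spanned by the matrix units $e_{ij}$ with $j-i=k$. $\mathcal{L}_{\mathbb{Z}_n}$ is the free Lie algebra over $F$ freely generated by the disjoint countable sets $Y=\{y_1,y_2,\dots\}$ (variables of degree $0$) and $Z^{g}=\{z^{g}_1,z^{g}_2,\dots\}$ for each $g\in\mathbb{Z}_n\setminus\{0\}$ (variables of degree $g$), with the induced $\mathbb{Z}_n$-grading. A $\mathbb{Z}_n$-graded polynomial identity of a graded Lie algebra $A$ is an element of $\mathcal{L}_{\mathbb{Z}_n}$ vanishing under every substitution of its variables by homogeneous elements of $A$ of the same degree. A $T_{\mathbb{Z}_n}$-ideal is a graded ideal of $\mathcal{L}_{\mathbb{Z}_n}$ invariant under all degree-preserving endomorphisms. $I$ denotes the $T_{\mathbb{Z}_n}$-ideal of $\mathbb{Z}_n$-graded identities of $UT_n(F)^{(-)}$ with the canonical grading. A $T_{\mathbb{Z}_n}$-ideal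 has the Specht property if every $T_{\mathbb{Z}_n}$-ideal containing it is finitely generated as a $T_{\mathbb{Z}_n}$-ideal. *)

(* Defs.v *)
From mathcomp Require Import all_boot all_order all_algebra.
Set Implicit Arguments. Unset Strict Implicit. Unset Printing Implicit Defensive.
Import GRing.Theory.
Local Open Scope ring_scope.

(* The free Z_n-graded Lie algebra L_{Z_n} over F, as the quotient of  *)
(* the term algebra below by the least congruence [lequiv] generated   *)
(* by the axioms of Lie algebras over F.                               *)
(* Variables: [LVar g i] is the i-th variable of degree g in Z_n,      *)
(* where Z_n = {0,...,n-1} ('I_n) with addition mod n.                 *)

Inductive LExpr (F : Type) (n : nat) : Type :=
| LVar of 'I_n & nat
| LZero
| LAdd of LExpr F n & LExpr F n
| LScale of F & LExpr F n
| LBr of LExpr F n & LExpr F n.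

Arguments LZero {F n}.
Arguments LVar {F n}.
Arguments LAdd {F n}.
Arguments LScale {F n}.
Arguments LBr {F n}.

Section FreeLie.
Variables (F : fieldType) (n : nat).
Local Notation E := (LExpr F n).

Inductive lequiv : E -> E -> Prop :=
| leq_refl a : lequiv a a
| leq_sym a b : lequiv a b -> lequiv b a
| leq_trans a b c : lequiv a b -> lequiv b c -> lequiv a c
| leq_addC_cong a a' b b' : lequiv a a' -> lequiv b b' -> lequiv (LAdd a b) (LAdd a' b')
| leq_scale_cong c a a' : lequiv a a' -> lequiv (LScale c a) (LScale c a')
| leq_br_cong a a' b b' : lequiv a a' -> lequiv b b' -> lequiv (LBr a b) (LBr a' b')
| leq_addA a b c : lequiv (LAdd a (LAdd b c)) (LAdd (LAdd a b) c)
| leq_addC a b : lequiv (LAdd a b) (LAdd b a)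
| leq_add0 a : lequiv (LAdd LZero a) a
| leq_scale0 a : lequiv (LScale 0 a) LZero
| leq_scale1 a : lequiv (LScale 1 a) a
| leq_scaleA c d a : lequiv (LScale c (LScale d a)) (LScale (c * d) a)
| leq_scaleDr c a b : lequiv (LScale c (LAdd a b)) (LAdd (LScale c a) (LScale c b))
| leq_scaleDl c d a : lequiv (LScale (c + d) a) (LAdd (LScale c a) (LScale d a))
| leq_brDl a b c : lequiv (LBr (LAdd a b) c) (LAdd (LBr a c) (LBr b c))
| leq_brDr a b c : lequiv (LBr a (LAdd b c)) (LAdd (LBr a b) (LBr a c))
| leq_brZl k a b : lequiv (LBr (LScale k a) b) (LScale k (LBr a b))
| leq_brZr k a b : lequiv (LBr a (LScale k b)) (LScale k (LBr a b))
| leq_alt a : lequiv (LBr a a) LZero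
| leq_jacobi a b c :
    lequiv (LAdd (LBr a (LBr b c)) (LAdd (LBr b (LBr c a)) (LBr c (LBr a b)))) LZero.

(* Homogeneous component of degree (d mod n). *)
Fixpoint lproj (d : nat) (e : E) {struct e} : E :=
  match e with
  | LVar g i => if (nat_of_ord g == d %% n)%N then LVar g i else LZero
  | LZero => LZero
  | LAdd a b => LAdd (lproj d a) (lproj d b)
  | LScale c a => LScale c (lproj d a)
  | LBr a b =>
      foldr (fun h acc => LAdd (LBr (lproj h a) (lproj (d + (n - h)) b)) acc)
            LZero (iota 0 n)
  end.

Definition lhomog (g : nat) (e : E) : Prop := lequiv e (lproj g e).

Fixpoint lsubst (s : 'I_n -> nat -> E) (e : E) : E :=
  match e with
  | LVar g i => s g i
  | LZero => LZero
  | LAdd a b => LAdd (lsubst s a) (lsubst s b)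
  | LScale c a => LScale c (lsubst s a)
  | LBr a b => LBr (lsubst s a) (lsubst s b)
  end.

Definition graded_subst (s : 'I_n -> nat -> E) : Prop :=
  forall (g : 'I_n) (i : nat), lhomog (nat_of_ord g) (s g i).

(* A subset of L_{Z_n} is a predicate on terms stable under [lequiv]. *)
Definition T_ideal (J : E -> Prop) : Prop :=
  (forall a b, lequiv a b -> J a -> J b) /\
  J LZero /\
  (forall a b, J a -> J b -> J (LAdd a b)) /\
  (forall c a, J a -> J (LScale c a)) /\
  (forall a b, J a -> J (LBr a b)) /\
  (forall a d, J a -> J (lproj d a)) /\
  (forall s a, graded_subst s -> J a -> J (lsubst s a)).

Fixpoint all_in (P : E -> Prop) (S : seq E) : Prop :=
  if S is f :: S' then P f /\ all_in P S' else True.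

Definition T_fin_gen (J : E -> Prop) : Prop :=
  exists S : seq E,
    all_in J S /\
    (forall K, T_ideal K -> all_in K S -> forall a, J a -> K a).

Definition lie_br (A B : 'M[F]_n) : 'M[F]_n := A *m B - B *m A.

Fixpoint leval (s : 'I_n -> nat -> 'M[F]_n) (e : E) : 'M[F]_n :=
  match e with
  | LVar g i => s g i
  | LZero => 0
  | LAdd a b => leval s a + leval s b
  | LScale c a => c *: leval s a
  | LBr a b => lie_br (leval s a) (leval s b)
  end.

Definition in_UT_comp (k : nat) (A : 'M[F]_n) : Prop :=
  forall i j : 'I_n, A i j != 0 -> nat_of_ord j = (nat_of_ord i + k)%N.

Definition UT_graded_subst (s : 'I_n -> nat -> 'M[F]_n) : Prop :=
  forall (g : 'I_n) (i : nat), in_UT_comp (nat_of_ord g) (s g i).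

Definition UT_graded_ids (e : E) : Prop :=
  forall s, UT_graded_subst s -> leval s e = 0.

End FreeLie.

(* Main.v *)
Require Import Defs.
From HB Require Import structures.
From Corelib Require Import Setoid Morphisms.
From mathcomp Require Import all_boot all_order all_algebra.
From mathcomp Require Import boolp generic_quotient.
Set Implicit Arguments. Unset Strict Implicit. Unset Printing Implicit Defensive.
Import GRing.Theory.

(** Modulo [y1,y2] and the left-normed commutators of n variables of nonzero
degree, which are finitely many elements of I, every element of the free algebra
is a linear combination of variables of degree 0 and of left-normed words of
fewer than n letters, a letter being a variable z of nonzero degree bracketed
with some variables y of degree 0, whose order is irrelevant.

For words that are multilinear in z_1, ..., z_d of prescribed degrees, the
substitutions z_j -> [z_j, y_i] and y_i -> y_(f i), f increasing, act on these
words as multiplications and index shifts act on the monomials in commuting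
variables t_(i,j).  Higman's lemma makes divisibility up to an increasing
renaming of i a well-quasi-order, so a Groebner basis argument (Cohen's theorem)
shows that the multilinear elements of J of each of the finitely many types come
from finitely many of them.

An arbitrary element of J is recovered from multilinear elements of J by
polarization and restitution, starting from the words of maximal length d; this
divides by d!, and d < n is where the characteristic enters. *)

(** * Well-quasi-orders and Higman's lemma *)

Definition wqo (T : Type) (r : T -> T -> Prop) :=
  forall f : nat -> T, exists i j, (i < j)%N /\ r (f i) (f j).

(** Indices with no later term above them are bounded, since infinitely many of them would form a
    bad sequence. Beyond the bound [M] one can always step to a later term that is larger. *)
Lemma wqo_monotone_subseq (T : Type) (r : T -> T -> Prop) :
  (forall y x z, r x y -> r y z -> r x z) -> wqo r ->
  forall f : nat -> T, exists h : nat -> nat,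
    {homo h : i j / (i < j)%N} /\
    forall i j, (i < j)%N -> r (f (h i)) (f (h j)).
Proof.
move=> rT rW f.
have [M HM] : exists M, forall i, exists j, (i < j)%N /\ ((M <= i)%N -> r (f i) (f j)).
  apply: contrapT => no.
  have : forall M, exists i, (M <= i)%N /\ forall j, (i < j)%N -> ~ r (f i) (f j).
    move=> M; apply: contrapT => noM; apply: no; exists M => i.
    have [leMi|ltiM] := leqP M i; last by exists i.+1.
    apply: contrapT => noi; apply: noM; exists i; split=> // j ltij rij.
    by apply: noi; exists j.
  move=> /choice[g gP].
  pose k := fix k n := if n is m.+1 then g (k m).+1 else g 0%N.
  have kS i : (k i < k i.+1)%N by have [] := gP (k i).+1.
  have kP i j : (k i < j)%N -> ~ r (f (k i)) (f j).
    by case: i => [|i]; apply: (gP _).2.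
  have [i [j [ltij rij]]] := rW (f \o k).
  by apply: kP rij; apply: (homo_ltn ltn_trans kS).
have [s sP] := choice HM.
pose h n := iter n s M.
have hS i : (h i < h i.+1)%N by have [] := sP (h i).
have hM i : (M <= h i)%N.
  by elim: i => //= i IH; apply: leq_trans IH (ltnW _); have [] := sP (h i).
exists h; split; first exact: (homo_ltn ltn_trans hS).
apply: (homo_ltn (f := fun n => f (h n)) rT) => i.
by have [_] := sP (h i); apply.
Qed.

Lemma wqo_leq : wqo (fun m n : nat => (m <= n)%N).
Proof.
move=> f; have ex : exists v, `[< exists i, f i = v >] by exists (f 0%N); apply/asboolP; exists 0%N.
case: (ex_minnP ex) => v /asboolP[i fi] vmin; exists i, i.+1; split=> //.
by rewrite fi; apply: vmin; apply/asboolP; exists i.+1.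
Qed.

Lemma wqo_eq_fin (P : finType) : wqo (@eq P).
Proof.
move=> f; have : ~~ injectiveb (fun i : 'I_#|P|.+1 => f i).
  by apply/negP => /injectiveP/leq_card; rewrite card_ord ltnn.
move=> /injectivePn[i [j neij fij]].
have [ltij|ltji|/val_inj eqij] := ltngtP i j; last by rewrite eqij eqxx in neij.
  by exists i, j.
by exists j, i.
Qed.

(** Dickson's lemma, by extracting monotone subsequences one coordinate at a time. *)
Lemma wqo_ffun (I : finType) : wqo (fun u v : {ffun I -> nat} => forall j, (u j <= v j)%N).
Proof.
move=> f.
suff [h [hM hP]] : exists h : nat -> nat, {homo h : i j / (i < j)%N} /\
    forall j, j \in enum I -> forall a b, (a < b)%N -> (f (h a) j <= f (h b) j)%N.
  exists (h 0%N), (h 1%N); split; first exact: hM.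
  by move=> j; apply: hP; rewrite // mem_enum.
elim: (enum I) => [|j s [h [hM hP]]]; first by exists id; split.
have [k [kM kP]] := wqo_monotone_subseq (fun _ _ _ => @leq_trans _ _ _) wqo_leq (fun n => f (h n) j).
exists (h \o k); split; first by move=> a b ab; apply/hM/kM.
move=> j'; rewrite inE => /orP[/eqP->|js] a b ab; first exact: kP.
by apply: hP => //; apply: kM.
Qed.

Inductive emb (T : Type) (r : T -> T -> Prop) : seq T -> seq T -> Prop :=
| emb_nil t : emb r [::] t
| emb_skip x s t : emb r s t -> emb r s (x :: t)
| emb_cons x y s t : r x y -> emb r s t -> emb r (x :: s) (y :: t).

Lemma ex_minimizer (T : Type) (P : T -> Prop) (m : T -> nat) :
  (exists x, P x) -> exists x, P x /\ forall y, P y -> (m x <= m y)%N.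
Proof.
move=> [x Px].
have ex : exists v, `[< exists2 z, P z & m z = v >] by exists (m x); apply/asboolP; exists x.
case: (ex_minnP ex) => v /asboolP[z Pz <-] vmin; exists z; split=> // y Py.
by apply: vmin; apply/asboolP; exists y.
Qed.

(** Recursion on the whole past, as needed for a minimal bad sequence and for greedy choices. *)
Lemma history_sequence (T : Type) (nx : seq T -> T) :
  exists f : nat -> T, forall n, f n = nx (mkseq f n).
Proof.
pose L := fix L n := if n is m.+1 then rcons (L m) (nx (L m)) else [::].
exists (fun n => nx (L n)) => n; congr nx.
by elim: n => //= n IH; rewrite mkseqS -IH.
Qed.

(* Nash-Williams' minimal bad sequence. *)
Theorem higman (T : Type) (r : T -> T -> Prop) :
  (forall y x z, r x y -> r y z -> r x z) -> wqo r -> wqo (emb r).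
Proof.
move=> rT rW f0; apply: contrapT => f0bad.
pose bad f := forall i j, (i < j)%N -> ~ emb r (f i) (f j).
(* [ext l] means that [l] begins some bad sequence; [nx] will extend such an [l] by a shortest
   possible term. *)
pose ext l := exists f, bad f /\ forall i, (i < size l)%N -> f i = nth [::] l i.
have ext0 : ext [::].
  exists f0; split=> // i j ij eij; apply: f0bad; by exists i, j.
have step l : exists x, ext l -> ext (rcons l x) /\
    forall y, ext (rcons l y) -> (size x <= size y)%N.
  have [El|] := pselect (ext l); last by move=> nEl; exists [::].
  have [x [Ex xmin]] := @ex_minimizer _ (fun x => ext (rcons l x)) size (ltac:(
    case: El => f [fb fl]; exists (f (size l)), f; split=> // i;
    rewrite size_rcons ltnS leq_eqVlt nth_rcons => /orP[/eqP->|il];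
    [by rewrite ltnn eqxx | by rewrite il fl])).
  by exists x.
have [nx nxP] := choice step.
have [f fE] := history_sequence nx.
have extf n : ext (mkseq f n).
  by elim: n => // n IH; rewrite mkseqS fE; apply: (nxP _ IH).1.
have fbad : bad f.
  move=> i j ij; have [g [gb gE]] := extf j.+1.
  have := gb _ _ ij; rewrite !gE ?size_mkseq ?nth_mkseq //; exact: ltnW.
have fmin g n : bad g -> (forall i, (i < n)%N -> g i = f i) -> (size (f n) <= size (g n))%N.
  move=> gb gE; rewrite fE; apply: (nxP _ (extf n)).2.
  exists g; split=> // i; rewrite size_rcons size_mkseq ltnS leq_eqVlt nth_rcons size_mkseq.
  by case/orP=> [/eqP->|lt_in]; rewrite ?ltnn ?eqxx // lt_in nth_mkseq // gE.
have fnil n : f n <> [::].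
  by move=> fn; apply: (fbad n n.+1) => //; rewrite fn; exact: emb_nil.
have [x0 _] : exists x0 : T, True.
  by have := fnil 0%N; case: (f 0%N) => // x; exists x.
have fC n : f n = head x0 (f n) :: behead (f n) by have := fnil n; case: (f n).
have [h [hM hP]] := wqo_monotone_subseq rT rW (fun n => head x0 (f n)).
(* Follow [f] before [h 0], then take tails of the terms along [h]. Heads increase along [h], so an
   embedding within [g] would lift to one within [f]; thus [g] is bad, yet shorter than [f] at index
   [h 0]. *)
pose g k := if (k < h 0)%N then f k else behead (f (h (k - h 0))%N).
have h0 k : (h 0 <= h k)%N by case: k => // k; apply/ltnW/hM.
have gbad : bad g.
  move=> i j ij; rewrite /g; have [jh|hj] := ltnP j (h 0).
    by rewrite (ltn_trans ij jh); apply: fbad.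
  have [ih|hi] := ltnP i (h 0) => eij.
    apply: (fbad i (h (j - h 0))%N); first exact: leq_trans ih (h0 _).
    by rewrite [f (h _)]fC; apply: emb_skip.
  have ij' : (i - h 0 < j - h 0)%N by rewrite ltn_sub2r // (leq_ltn_trans hi).
  apply: (fbad (h (i - h 0))%N (h (j - h 0))%N); first exact: hM.
  by rewrite fC [f (h (j - _))]fC; apply: emb_cons => //; apply: hP.
have /(fmin g (h 0) gbad) : forall i, (i < h 0)%N -> g i = f i.
  by move=> i ih; rewrite /g ih.
by rewrite /g ltnn subnn {1}fC /= ltnn.
Qed.

(** Otherwise one could go on choosing elements of [D] that lie above none of the earlier ones,
    which is a bad sequence. *)
Lemma wqo_finite_basis (T : eqType) (r : T -> T -> Prop) (D : T -> Prop) :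
  wqo r -> exists s : seq T, (forall x, x \in s -> D x) /\
    forall m, D m -> exists2 b, b \in s & r b m.
Proof.
move=> rW; apply: contrapT => no.
have step (s : seq T) : (forall x, x \in s -> D x) -> exists m, D m /\ forall b, b \in s -> ~ r b m.
  move=> sD; apply: contrapT => nos; apply: no; exists s; split=> // m Dm.
  apply: contrapT => nom; apply: nos; exists m; split=> // b bs rbm.
  by apply: nom; exists b.
have [m0 _] := step [::] (ltac:(done)).
have /choice[nx nxP] (s : seq T) : exists m, (forall x, x \in s -> D x) -> D m /\ forall b, b \in s -> ~ r b m.
  have [sD|nsD] := pselect (forall x, x \in s -> D x); last by exists m0.
  by have [m mP] := step s sD; exists m.
have [f fE] := history_sequence nx.
have fD n x : x \in mkseq f n -> D x.
  elim: n x => // n IH x; rewrite mkseqS mem_rcons inE => /orP[/eqP->|]; last exact: IH.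
  by rewrite fE; apply: (nxP _ IH).1.
have [i [j [ij]]] := rW f.
rewrite (fE j); apply: (nxP _ (fD j)).2.
by apply/mapP; exists i => //; rewrite mem_iota.
Qed.

(** * A Noetherian property up to increasing renaming *)

Section Lex.
Variables (T : eqType) (r : rel T).

(** The length test matters: on lists of varying length the lexicographic order need not be
    well-founded. *)
Fixpoint lex (s t : seq T) : bool :=
  match s, t with
  | x :: s', y :: t' => (r x y && (size s' == size t')) || ((x == y) && lex s' t')
  | _, _ => false
  end.

Lemma lex_size s t : lex s t -> size s = size t.
Proof.
elim: s t => [|x s IH] [|y t] //= /orP[/andP[_ /eqP->] //|/andP[_ /IH-> //]].
Qed.

Lemma lex_trans : transitive r -> transitive lex.
Proof.
move=> rT t s u; elim: s t u => [|x s IH] [|y t] [|z u] //=.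
case/orP=> [/andP[rxy /eqP st]|/andP[/eqP-> lst]];
  case/orP=> [/andP[ryz /eqP tu]|/andP[/eqP<- ltu]].
- by rewrite (rT _ _ _ rxy ryz) st tu eqxx.
- by rewrite rxy st (lex_size ltu) eqxx.
- by rewrite ryz (lex_size lst) tu eqxx.
- by rewrite eqxx (IH t) ?orbT.
Qed.

Lemma lex_total s t : (forall x y, [\/ x = y, r x y | r y x]) ->
  size s = size t -> [\/ s = t, lex s t | lex t s].
Proof.
move=> rtot; elim: s t => [|x s IH] [|y t] //=; first by constructor 1.
move=> [st]; case: (rtot x y) => [->|rxy|ryx].
- case: (IH t st) => [->|lst|lts]; first by constructor 1.
    by constructor 2; rewrite eqxx lst orbT.
  by constructor 3; rewrite eqxx lts orbT.
- by constructor 2; rewrite rxy st eqxx.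
- by constructor 3; rewrite ryx st eqxx.
Qed.

(** Comparable lists have the same length, so the induction runs over that length, then over the
    head, then over the tail. *)
Lemma lex_wf : well_founded r -> well_founded lex.
Proof.
move=> rwf s; move: {2}(size s) (erefl (size s)) => n.
elim: n s => [|n IHn] [|x s] sn; [| by [] | by [] |].
  by apply: Acc_intro => -[].
case: sn => sn; elim/(well_founded_ind rwf): x s sn => x IHx s sn.
have As := IHn s sn; elim: As sn => {}s _ IHs sn; apply: Acc_intro => -[|y t]; first by [].
rewrite /= => /orP[/andP[ryx /eqP ts]|/andP[/eqP-> lts]]; first by apply: IHx; rewrite ?ts.
by apply: IHs; [|rewrite (lex_size lts)].
Qed.

End Lex.

Lemma wf_ltn : well_founded (ltn : rel nat).
Proof. by move=> n; elim/ltn_ind: n => n IH; apply: Acc_intro => m /IH. Qed.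

(** * Exponent vectors and splicing of lists of vectors *)

Section VectorOrder.
Variable I : finType.
Local Notation vec := {ffun I -> nat}.

Definition vlt (a b : vec) := lex ltn (codom a) (codom b).
Definition vadd (a b : vec) : vec := [ffun j => (a j + b j)%N].

Lemma vlt_trans : transitive vlt.
Proof. by move=> b a c; apply: (lex_trans ltn_trans). Qed.

Lemma vlt_total a b : [\/ a = b, vlt a b | vlt b a].
Proof.
have [||ab|lab|lba] := @lex_total _ ltn (codom a) (codom b).
- by move=> x y; case: (ltngtP x y) => ?; [constructor 2|constructor 3|constructor 1].
- by rewrite !size_codom.
- constructor 1; apply/ffunP => j; have /eq_in_map := ab.
  by apply; rewrite mem_enum.
- by constructor 2.
- by constructor 3.
Qed.

Lemma vlt_wf : well_founded vlt.
Proof.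
move=> a; move: {2}(codom a) (erefl (codom a)) => s e.
elim/(well_founded_ind (lex_wf wf_ltn)): s a e => s IH a e.
by apply: Acc_intro => b ba; apply: IH (erefl _); rewrite -e.
Qed.

(** Compatibility with addition, as required of a monomial order. *)
Lemma vlt_add a b v : vlt a b -> vlt (vadd a v) (vadd b v).
Proof.
rewrite /vlt /codom /image_mem; elim: (enum _) => //= j s IH; rewrite !ffunE.
case/orP=> [/andP[ab _]|/andP[/eqP-> /IH->]].
  by rewrite ltn_add2r ab !size_map eqxx.
by rewrite eqxx orbT.
Qed.

(* An instruction list: [(true, v)] adds [v] to the next vector, [(false, v)]
   inserts [v] as a new vector. *)
Fixpoint splice (pi : seq (bool * vec)) (u : seq vec) : seq vec :=
  match pi with
  | [::] => [::]
  | (true, v) :: pi' => if u is a :: u' then vadd a v :: splice pi' u' else [::]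
  | (false, v) :: pi' => v :: splice pi' u
  end.

(** The number of vectors that [pi] consumes; [splice pi u] is meant for lists [u] of this
    length. *)
Definition keeps (pi : seq (bool * vec)) := count fst pi.

(** Divisibility yields an explicit multiplier: skipped entries become insertions, matched entries
    become additions of the difference. *)
Lemma emb_splice u w :
  emb (fun a b : vec => forall j, (a j <= b j)%N) u w ->
  exists2 pi, keeps pi = size u & splice pi u = w.
Proof.
elim=> {u w} [w|x u w _ [pi ku <-]|a b u w ab _ [pi ku <-]].
- exists [seq (false, v) | v <- w]; first by elim: w.
  by elim: w => //= v w ->.
- by exists ((false, x) :: pi).
- exists ((true, [ffun j => b j - a j]%N) :: pi); first by rewrite /= -ku.
  by congr cons; apply/ffunP => j; rewrite !ffunE subnKC.
Qed.

Lemma size_splice pi u v : keeps pi = size u -> keeps pi = size v ->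
  size (splice pi u) = size (splice pi v).
Proof.
elim: pi u v => [|[[] w] pi IH] u v //= ; last by move=> ku kv; rewrite (IH u v).
by case: u v => [|a u] [|b v] //= [ku] [kv]; rewrite (IH u v).
Qed.

(** Insertions fall at the same positions of both lists, so the first difference stays first and
    keeps its direction. Hence splicing carries leading monomials to leading monomials. *)
Lemma lex_splice pi u v : keeps pi = size u -> keeps pi = size v ->
  lex vlt u v -> lex vlt (splice pi u) (splice pi v).
Proof.
elim: pi u v => [|[[] w] pi IH] u v /=.
- by move/esym/size0nil->.
- case: u v => [|a u] [|b v] //= [ku] [kv] /orP[/andP[ab _]|/andP[/eqP-> uv]].
    by rewrite (vlt_add _ ab) (size_splice ku kv) eqxx.
  by rewrite eqxx IH ?orbT.
- by move=> ku kv uv; rewrite eqxx IH ?orbT.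
Qed.

End VectorOrder.

(** * Groebner reduction up to splicing *)

Section Noetherian.
Variables (F : fieldType) (P I : finType).
Local Notation vec := {ffun I -> nat}.
Local Notation mono := (P * seq vec)%type.
Local Notation fpoly := (seq (F * mono)).
Local Open Scope ring_scope.

Definition mlt (m m' : mono) :=
  (enum_rank m.1 < enum_rank m'.1)%N || (m.1 == m'.1) && lex (@vlt I) m.2 m'.2.

Lemma mlt_trans : transitive mlt.
Proof.
move=> [q v] [p u] [s w]; rewrite /mlt /=.
case/orP=> [pq|/andP[/eqP-> uv]] /orP[qs|/andP[/eqP<- vw]].
- by rewrite (ltn_trans pq qs).
- by rewrite pq.
- by rewrite qs.
- by rewrite eqxx (lex_trans (@vlt_trans I) uv vw) orbT.
Qed.

Lemma mlt_total m m' : size m.2 = size m'.2 -> [\/ m = m', mlt m m' | mlt m' m].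
Proof.
case: m m' => [p u] [q v] /= uv; rewrite /mlt /=.
have [pq|qp|/val_inj/enum_rank_inj->] := ltngtP (enum_rank p) (enum_rank q).
- by constructor 2.
- by constructor 3.
- rewrite eqxx /=; case: (lex_total (@vlt_total I) uv) => [->|->|->].
  + by constructor 1.
  + by constructor 2.
  + by constructor 3.
Qed.

Lemma mlt_wf : well_founded mlt.
Proof.
case=> p u; move: {2}(enum_rank p : nat) (erefl (enum_rank p : nat)) => k.
elim/ltn_ind: k p u => k IHk p u pk.
elim/(well_founded_ind (lex_wf (@vlt_wf I))): u => u IHu.
apply: Acc_intro => -[q v]; rewrite /mlt /= => /orP[qp|/andP[/eqP-> vu]]; last exact: IHu.
by apply: (IHk (enum_rank q)); rewrite -?pk.
Qed.

Definition peval (A : lmodType F) (th : P -> seq vec -> A) (f : fpoly) : A :=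
  \sum_(t <- f) t.1 *: th t.2.1 t.2.2.

(** An ideal is described dually, by the evaluations at which its members vanish. This avoids
    identifying lists of terms that denote the same polynomial. *)
Definition pvanish (A : lmodType F) (Th : (P -> seq vec -> A) -> Prop) (f : fpoly) :=
  forall th, Th th -> peval th f = 0.

(** Dual to stability of the vanishing polynomials under multiplication by [pi]. *)
Definition splice_closed (A : lmodType F) (Th : (P -> seq vec -> A) -> Prop) :=
  forall th pi, Th th -> exists2 th', Th th' &
    forall p u, size u = keeps pi -> th' p u = th p (splice pi u).

Definition homogp B (f : fpoly) := forall t, t \in f -> size t.2.2 = B.

Definition below (m : mono) (f : fpoly) :=
  forall t, t \in f -> size t.2.2 = size m.2 /\ mlt t.2 m.

Definition psplice pi (f : fpoly) : fpoly :=
  [seq (t.1, (t.2.1, splice pi t.2.2)) | t <- f].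

Definition pscale c (f : fpoly) : fpoly := [seq (c * t.1, t.2) | t <- f].

Lemma peval_scale (A : lmodType F) (th : P -> seq vec -> A) c f :
  peval th (pscale c f) = c *: peval th f.
Proof.
by rewrite /peval big_map scaler_sumr; apply: eq_bigr => t _; rewrite scalerA.
Qed.

Lemma peval_cat (A : lmodType F) (th : P -> seq vec -> A) f g :
  peval th (f ++ g) = peval th f + peval th g.
Proof. exact: big_cat. Qed.

Lemma peval_cons (A : lmodType F) (th : P -> seq vec -> A) t f :
  peval th (t :: f) = t.1 *: th t.2.1 t.2.2 + peval th f.
Proof. exact: big_cons. Qed.

Lemma pvanish_splice (A : lmodType F) (Th : (P -> seq vec -> A) -> Prop) pi f :
  splice_closed Th -> homogp (keeps pi) f -> pvanish Th f -> pvanish Th (psplice pi f).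
Proof.
move=> cl hf vf th Tth; have [th' Tth' thE] := cl th pi Tth.
rewrite /peval big_map -[RHS](vf _ Tth'); apply: eq_big_seq => t tf /=.
by rewrite thE // hf.
Qed.

Lemma below_psplice pi p u f : size u = keeps pi -> below (p, u) f ->
  below (p, splice pi u) (psplice pi f).
Proof.
move=> su bf t /mapP[t' /bf[/= st lt'] ->] /=.
split; first by apply: size_splice; rewrite ?st.
case/orP: lt' => [lt|/andP[/eqP e lt]]; rewrite /mlt /= ?lt // e eqxx lex_splice ?orbT //.
by rewrite st.
Qed.

Lemma poly_max (f : fpoly) B : homogp B f -> f != [::] ->
  exists2 t0, t0 \in f & forall t, t \in f -> t.2 = t0.2 \/ mlt t.2 t0.2.
Proof.
elim: f => // t f IH hf _; have ht : size t.2.2 = B by apply: hf; rewrite mem_head.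
have [f0|fn0] := eqVneq f [::].
  by exists t; rewrite ?mem_head // => t'; rewrite f0 inE => /eqP->; left.
have hf' : homogp B f by move=> t' t'f; apply: hf; rewrite inE t'f orbT.
have [t0 t0f t0P] := IH hf' fn0.
have [tm|tm|mt] := mlt_total (etrans ht (esym (hf' _ t0f))).
- exists t0; first by rewrite inE t0f orbT.
  by move=> t'; rewrite inE => /orP[/eqP->|/t0P//]; left.
- exists t0; first by rewrite inE t0f orbT.
  by move=> t'; rewrite inE => /orP[/eqP->|/t0P//]; right.
- exists t; first by rewrite mem_head.
  move=> t'; rewrite inE => /orP[/eqP->|/t0P[->|lt]]; first by left.
    by right.
  by right; apply: mlt_trans mt.
Qed.

Definition leading (A : lmodType F) (Th : (P -> seq vec -> A) -> Prop) (m : mono) :=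
  exists2 f, below m f & pvanish Th ((1, m) :: f).

Definition mdiv (m m' : mono) :=
  m.1 = m'.1 /\ emb (fun a b : vec => forall j, (a j <= b j)%N) m.2 m'.2.

(** Pigeonhole on the finite component, then Higman's lemma over Dickson's lemma along the
    subsequence found. *)
Lemma wqo_mdiv : wqo mdiv.
Proof.
move=> f.
have [h [hM hP]] := wqo_monotone_subseq (fun y x z => @eq_trans P x y z) (@wqo_eq_fin P) (fun n => (f n).1).
have leT (y x z : vec) : (forall j, (x j <= y j)%N) -> (forall j, (y j <= z j)%N) ->
    forall j, (x j <= z j)%N by move=> xy yz j; apply: leq_trans (xy j) (yz j).
have [i [j [ij eij]]] := higman leT (@wqo_ffun I) (fun n => (f (h n)).2).
by exists (h i), (h j); split; [apply: hM | split; [apply: hP|]].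
Qed.

(* Cohen's theorem: Groebner reduction, with divisibility of leading monomials
   replaced by the well-quasi-order [mdiv]. *)
Theorem finite_groebner_basis (A : lmodType F) (Th : (P -> seq vec -> A) -> Prop) :
  splice_closed Th ->
  exists G : seq fpoly, (forall g, g \in G -> pvanish Th g) /\
    forall (A' : lmodType F) (Th' : (P -> seq vec -> A') -> Prop), splice_closed Th' ->
      (forall g, g \in G -> pvanish Th' g) ->
      forall B f, homogp B f -> pvanish Th f -> pvanish Th' f.
Proof.
move=> cl; have [s [sL sP]] := wqo_finite_basis (leading Th) wqo_mdiv.
have /choice[tl tlP] m : exists f,
    leading Th m -> below m f /\ pvanish Th ((1, m) :: f).
  have [[f bf vf]|nL] := pselect (leading Th m); last by exists [::].
  by exists f.
exists [seq (1, m) :: tl m | m <- s]; split.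
  by move=> g /mapP[m ms ->]; have [] := tlP m (sL m ms).
move=> A' Th' cl' GTh'.
(* Well-founded induction on a bound [m] for the monomials of [f]; [m] itself need not occur in
   [f]. *)
have red (m : mono) : forall f, (forall t, t \in f -> size t.2.2 = size m.2 /\ (t.2 = m \/ mlt t.2 m)) ->
    pvanish Th f -> pvanish Th' f.
  elim/(well_founded_ind mlt_wf): m => m IHm f fm vf.
  have low g : below m g -> pvanish Th g -> pvanish Th' g.
    move=> bg vg; have [->|gn0] := eqVneq g [::]; first by move=> th _; rewrite /peval big_nil.
    have [|t0 t0g t0P] := @poly_max g (size m.2) _ gn0; first by move=> t /bg[].
    have [st0 t0m] := bg t0 t0g.
    apply: (IHm t0.2) => // t tg; have [st _] := bg t tg.
    by rewrite st st0; split=> //; apply: t0P.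
  (* A list may repeat a monomial, so the coefficient of [m] is a sum and may be 0. *)
  pose c := \sum_(t <- f | t.2 == m) t.1.
  pose f' := [seq t <- f | t.2 != m].
  have fE (B : lmodType F) (th : P -> seq vec -> B) : peval th f = c *: th m.1 m.2 + peval th f'.
    rewrite /peval (bigID (fun t => t.2 == m)) /= big_filter; congr (_ + _).
    by rewrite scaler_suml; apply: eq_bigr => t /eqP->.
  have bf' : below m f'.
    move=> t; rewrite mem_filter => /andP[tm /fm[st []]] // te.
    by rewrite te eqxx in tm.
  have [c0|cn0] := eqVneq c 0.
    have vf' : pvanish Th' f'.
      by apply: low => // th Tth; have := vf th Tth; rewrite fE c0 scale0r add0r.
    by move=> th Tth; rewrite fE c0 scale0r add0r vf'.
  (* Dividing by [c] exhibits [m] as leading, so a basis monomial [b] divides it and [pi] takes [b]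
     to [m]. *)
  have /sP[b bs [b1 /emb_splice[pi kb eb]]] : leading Th m.
    exists (pscale c^-1 f').
      by move=> t /mapP[t' /bf' ? ->].
    move=> th Tth; rewrite peval_cons peval_scale /=.
    rewrite -[X in X *: _](mulVf cn0) -scalerA -scalerDr -fE.
    by rewrite vf ?scaler0.
  have [bb vb] := tlP b (sL b bs).
  have bb' : below (b.1, b.2) (tl b) by rewrite -surjective_pairing.
  have mE : (b.1, splice pi b.2) = m by rewrite b1 eb -surjective_pairing.
  have spE (B : lmodType F) (th : P -> seq vec -> B) :
      peval th (psplice pi ((1, b) :: tl b)) = th m.1 m.2 + peval th (psplice pi (tl b)).
    by rewrite peval_cons /= scale1r b1 eb.
  have hb : homogp (keeps pi) ((1, b) :: tl b).
    by move=> t; rewrite kb inE => /orP[/eqP->|/bb[]].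
  have v1 := pvanish_splice cl hb vb.
  have v2 := pvanish_splice cl' hb (GTh' _ (map_f (fun m => (1, m) :: tl m) bs)).
  (* Subtracting [c] times the spliced basis polynomial cancels [m]. The remainder lies below [m]
     and vanishes on [Th], so the induction applies to it. *)
  have v3 : pvanish Th' (f' ++ pscale (- c) (psplice pi (tl b))).
    apply: low => [t|th Tth].
      rewrite mem_cat => /orP[/bf'//|/mapP[t' t'b ->]] /=; rewrite -mE.
      exact: (below_psplice (esym kb) bb').
    have := v1 _ Tth; rewrite spE => /eqP; rewrite addr_eq0 => /eqP e.
    by rewrite peval_cat peval_scale scaleNr -scalerN -e addrC -fE vf.
  move=> th Tth; have := v2 _ Tth; rewrite spE => /eqP; rewrite addr_eq0 => /eqP e.
  have := v3 _ Tth; rewrite peval_cat peval_scale scaleNr -scalerN -e => <-.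
  by rewrite fE addrC.
move=> B f hf vf; have [->|fn0] := eqVneq f [::]; first by move=> th _; rewrite /peval big_nil.
have [t0 t0f t0P] := poly_max hf fn0.
by apply: (red t0.2) vf => t tf; rewrite !hf //; split=> //; apply: t0P.
Qed.

End Noetherian.

(** * Quotients of the free Lie algebra *)

Section Congruence.
Variables (F : fieldType) (n : nat).
Local Notation E := (LExpr F n).
Local Open Scope ring_scope.

#[local] Instance lequiv_equivalence : Equivalence (@lequiv F n).
Proof.
by split; [exact: Defs.leq_refl | exact: Defs.leq_sym | exact: Defs.leq_trans].
Qed.

#[local] Instance lequiv_add : Proper (@lequiv F n ==> @lequiv F n ==> @lequiv F n) LAdd.
Proof. by move=> a a' ? b b' ?; apply: leq_addC_cong. Qed.

#[local] Instance lequiv_scale c : Proper (@lequiv F n ==> @lequiv F n) (LScale c).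
Proof. by move=> a a' ?; apply: leq_scale_cong. Qed.

#[local] Instance lequiv_br : Proper (@lequiv F n ==> @lequiv F n ==> @lequiv F n) LBr.
Proof. by move=> a a' ? b b' ?; apply: leq_br_cong. Qed.

#[local] Hint Resolve Defs.leq_refl : core.

Lemma lequiv_add0r (a : E) : lequiv (LAdd a LZero) a.
Proof. by rewrite leq_addC leq_add0. Qed.

Lemma lequiv_addN (a : E) : lequiv (LAdd a (LScale (-1) a)) LZero.
Proof. by rewrite -{1}[a]leq_scale1 -leq_scaleDl subrr leq_scale0. Qed.

Lemma lequiv_addACA (a b c d : E) :
  lequiv (LAdd (LAdd a b) (LAdd c d)) (LAdd (LAdd a c) (LAdd b d)).
Proof.
by rewrite -leq_addA [LAdd b (LAdd c d)]leq_addA [LAdd b c]leq_addC -!leq_addA.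
Qed.

Lemma lequiv_br0 (a : E) : lequiv (LBr a LZero) LZero.
Proof. by rewrite -{1}(leq_scale0 LZero) leq_brZr leq_scale0. Qed.

Lemma lequiv_0br (a : E) : lequiv (LBr LZero a) LZero.
Proof. by rewrite -{1}(leq_scale0 LZero) leq_brZl leq_scale0. Qed.

Lemma lequiv_brC (a b : E) : lequiv (LBr b a) (LScale (-1) (LBr a b)).
Proof.
have H : lequiv (LAdd (LBr a b) (LBr b a)) LZero.
  have := leq_alt (LAdd a b).
  by rewrite leq_brDl !leq_brDr !leq_alt leq_add0 lequiv_add0r.
rewrite -[LBr b a]leq_add0 -(lequiv_addN (LBr a b)) -leq_addA.
by rewrite [LAdd (LScale _ _) _]leq_addC leq_addA H leq_add0.
Qed.

Variable K : E -> Prop.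
Hypothesis KT : T_ideal K.

Lemma ideal_lequiv a b : lequiv a b -> K a -> K b.
Proof. by case: KT => H _; apply: H. Qed.

Definition kequiv (a b : E) := exists2 k, K k & lequiv a (LAdd b k).

Lemma lequiv_kequiv a b : lequiv a b -> kequiv a b.
Proof.
move=> ab; exists LZero; first by case: KT => _ [].
by rewrite lequiv_add0r.
Qed.

Lemma kequiv_sym a b : kequiv a b -> kequiv b a.
Proof.
move=> [k Kk ab]; exists (LScale (-1) k); first by case: KT => _ [_ [_ [+ _]]]; apply.
by rewrite ab -leq_addA lequiv_addN lequiv_add0r.
Qed.

Lemma kequiv_trans a b c : kequiv a b -> kequiv b c -> kequiv a c.
Proof.
move=> [k Kk ab] [l Kl bc]; exists (LAdd l k).
  by case: KT => _ [_ [+ _]]; apply.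
by rewrite ab bc leq_addA.
Qed.

Lemma kequiv_add a a' b b' : kequiv a a' -> kequiv b b' -> kequiv (LAdd a b) (LAdd a' b').
Proof.
move=> [k Kk ab] [l Kl bc]; exists (LAdd k l).
  by case: KT => _ [_ [+ _]]; apply.
by rewrite ab bc lequiv_addACA.
Qed.

Lemma kequiv_scale c a a' : kequiv a a' -> kequiv (LScale c a) (LScale c a').
Proof.
move=> [k Kk ab]; exists (LScale c k); first by case: KT => _ [_ [_ [+ _]]]; apply.
by rewrite ab leq_scaleDr.
Qed.

(** [T_ideal] only provides brackets with the element of the ideal on the left; the other side is
    reached by anticommutativity. *)
Lemma kequiv_br a a' b b' : kequiv a a' -> kequiv b b' -> kequiv (LBr a b) (LBr a' b').
Proof.
have Kbr u v : K u -> K (LBr u v) by case: KT => _ [_ [_ [_ [+ _]]]]; apply.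
move=> [k Kk ab] [l Kl bc]; apply: (@kequiv_trans _ (LBr a' b)).
  by exists (LBr k b); [exact: Kbr | rewrite ab leq_brDl].
exists (LBr a' l); last by rewrite bc leq_brDr.
apply: (@ideal_lequiv (LScale (-1) (LBr l a'))); first by rewrite -lequiv_brC.
by case: KT => _ [_ [_ [+ _]]]; apply; apply: Kbr.
Qed.

Lemma kequiv0 a : kequiv a LZero <-> K a.
Proof.
split=> [[k Kk ak]|Ka]; first by apply: ideal_lequiv Kk; rewrite ak leq_add0.
by exists a => //; rewrite leq_add0.
Qed.

End Congruence.

HB.instance Definition _ (F : fieldType) (n : nat) := gen_eqMixin (LExpr F n).
HB.instance Definition _ (F : fieldType) (n : nat) := gen_choiceMixin (LExpr F n).

Section Quotient.
Variables (F : fieldType) (n : nat) (K : LExpr F n -> Prop).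
Hypothesis KT : T_ideal K.
Local Notation E := (LExpr F n).
Local Open Scope ring_scope.
Local Open Scope quotient_scope.

Definition kequivb : rel E := fun a b => `[< kequiv K a b >].

Lemma kequivb_equiv : equiv_class_of kequivb.
Proof.
split=> [a|a b|b a c].
- exact/asboolP/lequiv_kequiv/Defs.leq_refl.
- by apply/asboolP/asboolP; apply: kequiv_sym.
- by move=> /asboolP ab /asboolP bc; apply/asboolP; apply: kequiv_trans ab bc.
Qed.

Canonical kequivb_rel := EquivRelPack kequivb_equiv.
Canonical kequivb_enc := defaultEncModRel kequivb_rel.

Definition lquot := {eq_quot kequivb_rel}.
HB.instance Definition _ : EqQuotient E kequivb_rel lquot := EqQuotient.on lquot.
HB.instance Definition _ := Choice.on lquot.

Local Notation pi := (\pi_lquot : E -> lquot).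

Lemma lpiP a b : pi a = pi b <-> kequiv K a b.
Proof.
split=> [/eqP|ab]; first by rewrite eqquotE => /asboolP.
by apply/eqP; rewrite eqquotE; apply/asboolP.
Qed.

Definition lq_add (x y : lquot) : lquot := locked (pi (LAdd (repr x) (repr y))).
Definition lq_scale c (x : lquot) : lquot := locked (pi (LScale c (repr x))).
Definition lq_br (x y : lquot) : lquot := locked (pi (LBr (repr x) (repr y))).

Lemma lpiD a b : pi (LAdd a b) = lq_add (pi a) (pi b).
Proof. by rewrite /lq_add -lock; apply/lpiP; apply: kequiv_add => //; apply/lpiP; rewrite reprK. Qed.

Lemma lpiZ c a : pi (LScale c a) = lq_scale c (pi a).
Proof. by rewrite /lq_scale -lock; apply/lpiP; apply: kequiv_scale => //; apply/lpiP; rewrite reprK. Qed.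

Lemma lpiBr a b : pi (LBr a b) = lq_br (pi a) (pi b).
Proof. by rewrite /lq_br -lock; apply/lpiP; apply: kequiv_br => //; apply/lpiP; rewrite reprK. Qed.

Lemma lpi_lequiv a b : lequiv a b -> pi a = pi b.
Proof. by move=> ab; apply/lpiP/lequiv_kequiv. Qed.

Lemma lq_addA : associative lq_add.
Proof. by elim/quotW=> a; elim/quotW=> b; elim/quotW=> c; rewrite -!lpiD; apply/lpi_lequiv/leq_addA. Qed.

Lemma lq_addC : commutative lq_add.
Proof. by elim/quotW=> a; elim/quotW=> b; rewrite -!lpiD; apply/lpi_lequiv/leq_addC. Qed.

Lemma lq_add0 : left_id (pi LZero) lq_add.
Proof. by elim/quotW=> a; rewrite -!lpiD; apply/lpi_lequiv/leq_add0. Qed.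

Lemma lq_addN : left_inverse (pi LZero) (lq_scale (-1)) lq_add.
Proof.
elim/quotW=> a; rewrite lq_addC -lpiZ -lpiD; apply/lpi_lequiv/lequiv_addN.
Qed.

HB.instance Definition _ := GRing.isZmodule.Build lquot lq_addA lq_addC lq_add0 lq_addN.

Lemma lq_scaleA c d x : lq_scale c (lq_scale d x) = lq_scale (c * d) x.
Proof. by elim/quotW: x => a; rewrite -!lpiZ; apply/lpi_lequiv/leq_scaleA. Qed.

Lemma lq_scale1 : left_id 1 lq_scale.
Proof. by elim/quotW=> a; rewrite -!lpiZ; apply/lpi_lequiv/leq_scale1. Qed.

Lemma lq_scaleDr : right_distributive lq_scale +%R.
Proof.
move=> c; elim/quotW=> a; elim/quotW=> b; rewrite -[LHS]/(lq_scale c (lq_add _ _)).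
by rewrite -[RHS]/(lq_add _ _) -lpiD -!lpiZ -lpiD; apply/lpi_lequiv/leq_scaleDr.
Qed.

Lemma lq_scaleDl x : {morph lq_scale^~ x : c d / c + d}.
Proof.
move=> c d; elim/quotW: x => a; rewrite -[RHS]/(lq_add _ _).
by rewrite -!lpiZ -lpiD; apply/lpi_lequiv/leq_scaleDl.
Qed.

HB.instance Definition _ := GRing.Zmodule_isLmodule.Build F lquot
  lq_scaleA lq_scale1 lq_scaleDr lq_scaleDl.

Definition lpi (a : E) : lquot := pi a.

Lemma lpi_add a b : lpi (LAdd a b) = lpi a + lpi b. Proof. exact: lpiD. Qed.
Lemma lpi_scale c a : lpi (LScale c a) = c *: lpi a. Proof. exact: lpiZ. Qed.
Lemma lpi_br a b : lpi (LBr a b) = lq_br (lpi a) (lpi b). Proof. exact: lpiBr. Qed.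
Lemma lpi_zero : lpi LZero = 0. Proof. by []. Qed.
Lemma lpi_eq a b : lequiv a b -> lpi a = lpi b. Proof. exact: lpi_lequiv. Qed.

Lemma lpi_eq0 a : lpi a = 0 <-> K a.
Proof. by rewrite -lpi_zero -(kequiv0 KT); apply: lpiP. Qed.

Lemma lpiW (P : lquot -> Prop) : (forall a, P (lpi a)) -> forall x, P x.
Proof. by move=> PP; elim/quotW. Qed.

End Quotient.

(* Degrees need not add up: the substitutions used below only bracket with
   elements of degree 0. *)
Record gmodel (F : fieldType) (N : nat) := GModel {
  gm_sort :> lmodType F;
  gm_br : gm_sort -> gm_sort -> gm_sort;
  gm_gr : 'I_N.+1 -> gm_sort -> Prop;
  gm_brDl : forall x y z, gm_br (x + y)%R z = (gm_br x z + gm_br y z)%R;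
  gm_brDr : forall x y z, gm_br x (y + z)%R = (gm_br x y + gm_br x z)%R;
  gm_brZl : forall c x y, gm_br (c *: x)%R y = (c *: gm_br x y)%R;
  gm_brZr : forall c x y, gm_br x (c *: y)%R = (c *: gm_br x y)%R;
  gm_alt : forall x, gm_br x x = 0%R;
  gm_jacobi : forall x y z,
    (gm_br x (gm_br y z) + (gm_br y (gm_br z x) + gm_br z (gm_br x y)))%R = 0%R;
  gm_gr0 : forall g, gm_gr g 0%R;
  gm_grD : forall g x y, gm_gr g x -> gm_gr g y -> gm_gr g (x + y)%R;
  gm_grBr : forall g x y, gm_gr g x -> gm_gr ord0 y -> gm_gr g (gm_br x y)
}.

Section Eval.
Variables (F : fieldType) (N : nat) (M : gmodel F N).
Local Open Scope ring_scope.

Fixpoint lev (v : 'I_N.+1 -> nat -> M) (e : LExpr F N.+1) : M :=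
  match e with
  | LVar g i => v g i
  | LZero => 0
  | LAdd a b => lev v a + lev v b
  | LScale c a => c *: lev v a
  | LBr a b => gm_br (lev v a) (lev v b)
  end.

Definition graded_val (v : 'I_N.+1 -> nat -> M) := forall g i, gm_gr g (v g i).

Definition sat (e : LExpr F N.+1) := forall v, graded_val v -> lev v e = 0.

End Eval.

(* A syntactic class of homogeneous terms, for which [lproj] can be computed
   without knowing that it respects [lequiv]. *)
Inductive shomog (F : fieldType) (N : nat) (g : 'I_N.+1) : LExpr F N.+1 -> Prop :=
| shomog_var i : shomog g (LVar g i)
| shomog_zero : shomog g LZero
| shomog_add a b : shomog g a -> shomog g b -> shomog g (LAdd a b)
| shomog_br a b : shomog g a -> shomog ord0 b -> shomog g (LBr a b).

(** * The quotient by a T-ideal as a graded model *)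

Section QuotientModel.
Variables (F : fieldType) (N : nat) (K : LExpr F N.+1 -> Prop).
Hypothesis KT : T_ideal K.
Local Notation E := (LExpr F N.+1).
Local Open Scope ring_scope.

(** In the sum that defines [lproj d] of a bracket only the index [h = g] survives, and there the
    second factor survives exactly when [d] is congruent to [g]. *)
Lemma lproj_shomog g (e : E) : shomog g e -> forall d,
  if (d %% N.+1 == g)%N then lequiv (lproj d e) e else lequiv (lproj d e) LZero.
Proof.
elim=> {g e} [g i|g|g a b _ IHa _ IHb|g a b _ IHa _ IHb] d.
- by rewrite /= [nat_of_ord g == _]eq_sym; case: (_ == _); apply: Defs.leq_refl.
- by case: ifP => _; apply: Defs.leq_refl.
- have := IHa d; have := IHb d; case: ifP => _ Hb Ha; first exact: leq_addC_cong.
  by apply: Defs.leq_trans (leq_addC_cong Ha Hb) _; apply: leq_add0.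
pose body h acc : E := LAdd (LBr (lproj h a) (lproj (d + (N.+1 - h)) b)) acc.
rewrite -[lproj d _]/(foldr body LZero (iota 0 N.+1)).
have term h : (h < N.+1)%N ->
    lequiv (LBr (lproj h a) (lproj (d + (N.+1 - h)) b))
      (if (h == g :> nat) && (d %% N.+1 == g)%N then LBr a b else LZero).
  move=> hN; have [hg|hg] := eqVneq h g; last first.
    have := IHa h; rewrite modn_small // (negbTE hg) => Ha.
    by apply: Defs.leq_trans (leq_br_cong Ha (Defs.leq_refl _)) _; apply: lequiv_0br.
  have := IHa h; rewrite modn_small // {1}hg eqxx => Ha.
  (* [d + (N.+1 - h)] represents [d - h] modulo [N.+1]; the truncated subtraction is exact because
     [h < N.+1]. *)
  have -> : (d %% N.+1 == g)%N = ((d + (N.+1 - h)) %% N.+1 == 0)%N.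
    have := eqn_modDr (N.+1 - h) d h N.+1.
    by rewrite subnKC ?(ltnW hN) // modnn (modn_small hN) hg => ->.
  have := IHb (d + (N.+1 - h))%N; rewrite /=; case: ifP => _ Hb; first exact: leq_br_cong.
  by apply: Defs.leq_trans (leq_br_cong Ha Hb) _; apply: lequiv_br0.
have main s : uniq s -> (forall h, h \in s -> (h < N.+1)%N) -> lequiv (foldr body LZero s)
    (if (nat_of_ord g \in s) && (d %% N.+1 == g)%N then LBr a b else LZero).
  elim: s => [|h s IHs] /=; first by move=> *; apply: Defs.leq_refl.
  move=> /andP[hs us] sub; rewrite inE.
  have hN := sub h (mem_head _ _).
  have /(IHs us) IH : forall k, k \in s -> (k < N.+1)%N.
    by move=> k ks; apply: sub; rewrite inE ks orbT.
  apply: Defs.leq_trans (leq_addC_cong (term h hN) IH) _.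
  have [hg|hg] := eqVneq h g; last exact: leq_add0.
  by rewrite -hg (negbTE hs) /=; apply: lequiv_add0r.
have /main := iota_uniq 0 N.+1.
have -> : (nat_of_ord g \in iota 0 N.+1) by rewrite mem_iota /= ltn_ord.
by rewrite andTb; case: ifP => _; apply => h; rewrite mem_iota.
Qed.

Lemma shomog_lhomog g (e : E) : shomog g e -> lhomog g e.
Proof. by move=> /lproj_shomog/(_ g); rewrite modn_small // eqxx => /Defs.leq_sym. Qed.

Definition lquot_gr g (x : lquot KT) := exists2 a, shomog g a & x = lpi KT a.

Program Definition quot_model : gmodel F N :=
  @GModel F N (lquot KT) (@lq_br _ _ _ KT) lquot_gr _ _ _ _ _ _ _ _ _.
Next Obligation.
elim/lpiW: x => a; elim/lpiW: y => b; elim/lpiW: z => c.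
by rewrite -!(lpi_add, lpi_br); apply/lpi_eq/leq_brDl.
Qed.
Next Obligation.
elim/lpiW: x => a; elim/lpiW: y => b; elim/lpiW: z => c.
by rewrite -!(lpi_add, lpi_br); apply/lpi_eq/leq_brDr.
Qed.
Next Obligation.
elim/lpiW: x => a; elim/lpiW: y => b.
by rewrite -!(lpi_scale, lpi_br); apply/lpi_eq/leq_brZl.
Qed.
Next Obligation.
elim/lpiW: x => a; elim/lpiW: y => b.
by rewrite -!(lpi_scale, lpi_br); apply/lpi_eq/leq_brZr.
Qed.
Next Obligation.
elim/lpiW: x => a; rewrite -lpi_br -lpi_zero; apply/lpi_eq/leq_alt.
Qed.
Next Obligation.
elim/lpiW: x => a; elim/lpiW: y => b; elim/lpiW: z => c.
by rewrite -!(lpi_br, lpi_add) -(lpi_zero KT); apply/lpi_eq/leq_jacobi.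
Qed.
Next Obligation. by exists LZero; [apply: shomog_zero | rewrite lpi_zero]. Qed.
Next Obligation.
case: H H0 => [a ga ->] [b gb ->].
by exists (LAdd a b); [apply: shomog_add | rewrite lpi_add].
Qed.
Next Obligation.
case: H H0 => [a ga ->] [b gb ->].
by exists (LBr a b); [apply: shomog_br | rewrite lpi_br].
Qed.

Lemma lev_lsubst (s : 'I_N.+1 -> nat -> E) e :
  lev (M := quot_model) (fun g i => lpi KT (s g i)) e = lpi KT (lsubst s e).
Proof.
elim: e => //= [a IHa b IHb|c a IHa|a IHa b IHb].
- by rewrite IHa IHb lpi_add.
- by rewrite IHa lpi_scale.
- by rewrite IHa IHb lpi_br.
Qed.

(** A T-ideal consists of the identities of its own quotient. One direction evaluates at the classes
    of the variables; the other lifts a valuation to a graded substitution, under which [K] is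
    stable. *)
Lemma sat_quot_model e : sat quot_model e <-> K e.
Proof.
split=> [sate|Ke v gv].
  have /sate : graded_val (M := quot_model) (fun g i => lpi KT (LVar g i)).
    by move=> g i; exists (LVar g i) => //; apply: shomog_var.
  rewrite lev_lsubst => /lpi_eq0; congr K.
  by elim: e {sate} => //= [a -> b ->|c a ->|a -> b ->].
have /choice[s sP] (p : 'I_N.+1 * nat) : exists a, shomog p.1 a /\ v p.1 p.2 = lpi KT a.
  by have [a] := gv p.1 p.2; exists a.
have -> : v = fun g i => lpi KT (s (g, i)).
  by apply/funext => g; apply/funext => i; have [_] := sP (g, i).
rewrite (lev_lsubst (fun g i => s (g, i))); apply/lpi_eq0.
case: KT => _ [_ [_ [_ [_ [_ +]]]]]; apply=> // g i.
by apply: shomog_lhomog; have [] := sP (g, i).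
Qed.

End QuotientModel.

(** * Normal forms *)

Section Bracket.
Variables (F : fieldType) (N : nat) (M : gmodel F N).
Local Notation br := (@gm_br F N M).
Implicit Types (a b x z : M).
Local Open Scope ring_scope.

Lemma br0l x : br 0 x = 0.
Proof. by rewrite -{1}(scale0r 0) gm_brZl scale0r. Qed.

Lemma br0r x : br x 0 = 0.
Proof. by rewrite -{1}(scale0r 0) gm_brZr scale0r. Qed.

Lemma br_suml (I : Type) (s : seq I) (P : pred I) (f : I -> M) x :
  br (\sum_(i <- s | P i) f i) x = \sum_(i <- s | P i) br (f i) x.
Proof. by apply: (big_morph (br^~ x)) => [a b|]; rewrite ?gm_brDl ?br0l. Qed.

Lemma br_sumr (I : Type) (s : seq I) (P : pred I) (f : I -> M) x :
  br x (\sum_(i <- s | P i) f i) = \sum_(i <- s | P i) br x (f i).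
Proof. by apply: (big_morph (br x)) => [a b|]; rewrite ?gm_brDr ?br0r. Qed.

Lemma brC x z : br x z = - br z x.
Proof.
apply/eqP; rewrite -addr_eq0; have := gm_alt (x + z).
by rewrite gm_brDl !gm_brDr !gm_alt add0r addr0 => ->.
Qed.

Lemma brNl x z : br (- x) z = - br x z.
Proof. by rewrite -scaleN1r gm_brZl scaleN1r. Qed.

Lemma br_der a b c : br (br a b) c = br (br a c) b + br a (br b c).
Proof.
have := gm_jacobi a b c; rewrite (brC b (br c a)) (brC c (br a b)) (brC c a) brNl opprK.
by move=> /eqP; rewrite addrA subr_eq0 => /eqP <-; rewrite addrC.
Qed.

Definition ycomm (y : nat -> M) := forall i j, br (y i) (y j) = 0.

(* [es] lists the exponents: [x] is bracketed [es`_i] times with [y i]. *)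
Fixpoint act (y : nat -> M) (es : seq nat) x : M :=
  if es is e :: es' then act (fun i => y i.+1) es' (iter e (br^~ (y 0)) x) else x.

Lemma br_iter x z z' e : br z' z = 0 -> br (iter e (br^~ z') x) z = iter e (br^~ z') (br x z).
Proof. by move=> zz'; elim: e => //= e IH; rewrite br_der zz' br0r addr0 IH. Qed.

Lemma act_br y es x z : (forall i, br (y i) z = 0) -> act y es (br x z) = br (act y es x) z.
Proof. by elim: es y x => //= e es IH y x yz; rewrite -br_iter // IH. Qed.

Lemma act_iter y es x z e : (forall i, br (y i) z = 0) ->
  act y es (iter e (br^~ z) x) = iter e (br^~ z) (act y es x).
Proof. by move=> yz; elim: e => //= e IH; rewrite act_br // IH. Qed.

Lemma actD y es : {morph act y es : a b / a + b}.
Proof.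
elim: es y => //= e es IH y a b; rewrite -IH; congr act.
by elim: e => //= e ->; rewrite gm_brDl.
Qed.

Lemma act0 y es : act y es 0 = 0.
Proof.
elim: es y => //= e es IH y; rewrite -[RHS](IH (fun i => y i.+1)); congr act.
by elim: e => //= e ->; rewrite br0l.
Qed.

Lemma act_sum y es (I : Type) (s : seq I) (P : pred I) (f : I -> M) :
  act y es (\sum_(i <- s | P i) f i) = \sum_(i <- s | P i) act y es (f i).
Proof. by apply: (big_morph (act y es)); [apply: actD | apply: act0]. Qed.

Lemma act_incr y es i x : ycomm y -> act y (incr_nth es i) x = br (act y es x) (y i).
Proof.
elim: i es y x => [|i IH] [|e es] y x yc //=.
- by rewrite act_br.
- have -> : ncons i 0 [:: 1]%N = incr_nth [::] i by case: (i).
  by rewrite (IH [::] (fun j => y j.+1)) // => j k; apply: yc.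
- by rewrite IH // => j k; apply: yc.
Qed.

(** Allows all exponent lists of a polynomial to be brought to one length. *)
Lemma act_pad y es k x : act y (es ++ nseq k 0%N) x = act y es x.
Proof. by elim: es y x => [|e es IH] //= y x; elim: k y => //= k IH. Qed.

Lemma act_graded y es x g : (forall i, gm_gr ord0 (y i)) -> gm_gr g x -> gm_gr g (act y es x).
Proof.
elim: es y x => //= e es IH y x yg xg; apply: IH => //.
by elim: e => //= e IHe; apply: gm_grBr.
Qed.

(** * Left-normed words, their derivatives and products *)

Section Words.
Variable L : eqType.
Local Notation word := (seq (L * seq nat)).
Implicit Types (X : L -> M) (Y : nat -> M) (w u v : word).

Definition evl X Y (l : L * seq nat) : M := act Y l.2 (X l.1).
Definition evfrom X Y a w : M := foldl (fun a l => br a (evl X Y l)) a w.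
Definition evw X Y w : M := if w is l :: w' then evfrom X Y (evl X Y l) w' else 0.
Definition evZ X Y (Z : seq (F * word)) : M := \sum_(t <- Z) t.1 *: evw X Y t.2.

Lemma evfromD X Y w : {morph evfrom X Y ^~ w : a b / a + b}.
Proof. by elim: w => //= l w IH a b; rewrite gm_brDl IH. Qed.

Lemma evfrom0 X Y w : evfrom X Y 0 w = 0.
Proof. by elim: w => //= l w IH; rewrite br0l. Qed.

Lemma evfrom_sum X Y w (I : Type) (s : seq I) (P : pred I) (f : I -> M) :
  evfrom X Y (\sum_(i <- s | P i) f i) w = \sum_(i <- s | P i) evfrom X Y (f i) w.
Proof.
by apply: (big_morph (evfrom X Y ^~ w)); [apply: evfromD | apply: evfrom0].
Qed.

Lemma evZ_cat X Y Z Z' : evZ X Y (Z ++ Z') = evZ X Y Z + evZ X Y Z'.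
Proof. exact: big_cat. Qed.

(** The Leibniz rule for the derivation given by bracketing with [y_i]: one summand for each letter
    that absorbs the new [y_i]. *)
Fixpoint wder i w : seq word :=
  if w is (l, es) :: w' then ((l, incr_nth es i) :: w') :: [seq (l, es) :: u | u <- wder i w']
  else [::].

Lemma evfrom_der X Y i a w : ycomm Y ->
  br (evfrom X Y a w) (Y i) =
    evfrom X Y (br a (Y i)) w + \sum_(u <- wder i w) evfrom X Y a u.
Proof.
move=> yc; elim: w a => [|[l es] w IH] a /=; first by rewrite big_nil addr0.
rewrite IH br_der evfromD -addrA; congr (_ + _).
by rewrite big_cons /= /evl /= act_incr //; congr (_ + _); rewrite big_map.
Qed.

Lemma evw_der X Y i w : ycomm Y ->
  br (evw X Y w) (Y i) = \sum_(u <- wder i w) evw X Y u.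
Proof.
case: w => [|[l es] w] yc; first by rewrite big_nil /= br0l.
by rewrite /= evfrom_der // big_cons big_map /= /evl /= act_incr.
Qed.

(* Right multiplication by a left-normed commutator, expanded with
   [a,[b,l]] = [[a,b],l] - [[a,l],b]. *)
Definition wadj_from (P : seq (F * word)) w :=
  foldl (fun P l => [seq (t.1, rcons t.2 l) | t <- P] ++ [seq (- t.1, l :: t.2) | t <- P]) P w.

Lemma evfrom_rcons X Y a w l : evfrom X Y a (rcons w l) = br (evfrom X Y a w) (evl X Y l).
Proof. by rewrite /evfrom -cats1 foldl_cat. Qed.

Lemma br_wadj X Y P b w :
  (forall a, br a b = \sum_(t <- P) t.1 *: evfrom X Y a t.2) ->
  forall a, br a (evfrom X Y b w) = \sum_(t <- wadj_from P w) t.1 *: evfrom X Y a t.2.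
Proof.
elim: w P b => [|l w IH] P b //= Pb; apply: IH => a.
rewrite big_cat !big_map /=.
have -> : br a (br b (evl X Y l)) = br (br a b) (evl X Y l) - br (br a (evl X Y l)) b.
  by rewrite br_der addrAC addrN add0r.
rewrite !Pb br_suml -sumrN; congr (_ + _); apply: eq_bigr => t _.
  by rewrite gm_brZl evfrom_rcons.
by rewrite scaleNr.
Qed.

(** The list is empty as soon as one factor is the empty word, in agreement with [evw], which sends
    that word to 0. *)
Definition wbr u v : seq (F * word) :=
  if (u, v) is (_ :: _, l :: v') then
    [seq (t.1, u ++ t.2) | t <- wadj_from [:: (1, [:: l])] v'] else [::].

Lemma evw_br X Y u v : br (evw X Y u) (evw X Y v) = evZ X Y (wbr u v).
Proof.
rewrite /evZ; case: u => [|k u]; first by rewrite big_nil br0l.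
case: v => [|l v]; first by rewrite big_nil br0r.
rewrite /= (@br_wadj _ _ [:: (1, [:: l])]) => [|a].
  by rewrite big_map; apply: eq_bigr => t _ /=; rewrite /evfrom foldl_cat.
by rewrite big_seq1 scale1r.
Qed.

End Words.
End Bracket.

Section NormalForm.
Variables (F : fieldType) (N : nat).
Local Open Scope ring_scope.
Local Notation label := ('I_N * nat)%type.
Local Notation word := (seq (label * seq nat)).

(* A nonzero degree [lift ord0 k] of Z_(N+1) is encoded by [k : 'I_N]; the first
   component collects the variables of degree 0. *)
Fixpoint nf (e : LExpr F N.+1) : seq (F * nat) * seq (F * word) :=
  match e with
  | LVar g i => if unlift ord0 g is Some h then ([::], [:: (1, [:: ((h, i), [::])])])
                else ([:: (1, i)], [::])
  | LZero => ([::], [::])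
  | LAdd a b => ((nf a).1 ++ (nf b).1, (nf a).2 ++ (nf b).2)
  | LScale c a => ([seq (c * t.1, t.2) | t <- (nf a).1], [seq (c * t.1, t.2) | t <- (nf a).2])
  | LBr a b => ([::],
      flatten [seq flatten [seq [seq (t.1 * u.1 * w.1, w.2) | w <- wbr F t.2 u.2]
        | u <- (nf b).2] | t <- (nf a).2] ++
      (flatten [seq flatten [seq [seq (t.1 * u.1, w) | w <- wder u.2 t.2]
        | u <- (nf b).1] | t <- (nf a).2] ++
       flatten [seq flatten [seq [seq (- (t.1 * u.1), w) | w <- wder u.2 t.2]
        | u <- (nf a).1] | t <- (nf b).2]))
  end.

Definition evY (M : gmodel F N) (Y : nat -> M) (s : seq (F * nat)) : M :=
  \sum_(t <- s) t.1 *: Y t.2.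

Definition zpart (M : gmodel F N) (v : 'I_N.+1 -> nat -> M) (l : label) : M :=
  v (lift ord0 l.1) l.2.

(** By [ycomm] the bracket of two sums of degree-0 variables is 0, which is why [nf] gives a bracket
    an empty first component. *)
Lemma lev_nf (M : gmodel F N) (v : 'I_N.+1 -> nat -> M) e : ycomm (v ord0) ->
  lev v e = evY (v ord0) (nf e).1 + evZ (zpart v) (v ord0) (nf e).2.
Proof.
move=> yc; elim: e => [g i||a IHa b IHb|c a IHa|a IHa b IHb] /=.
- case: unliftP => [h ->|->] /=; rewrite /evY /evZ big_nil big_seq1 scale1r ?addr0 //.
  by rewrite add0r.
- by rewrite /evY /evZ !big_nil addr0.
- by rewrite IHa IHb evZ_cat /evY big_cat addrACA.
- rewrite IHa scalerDr /evY /evZ !big_map !scaler_sumr; congr (_ + _).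
    by apply: eq_bigr => t _; rewrite scalerA.
  by apply: eq_bigr => t _; rewrite scalerA.
set Ya := (nf a).1 in IHa *; set Za := (nf a).2 in IHa *.
set Yb := (nf b).1 in IHb *; set Zb := (nf b).2 in IHb *.
have dE Z Y : gm_br (evZ (zpart v) (v ord0) Z) (evY (v ord0) Y) =
    \sum_(t <- Z) \sum_(u <- Y) \sum_(w <- wder u.2 t.2)
      (t.1 * u.1) *: evw (zpart v) (v ord0) w.
  rewrite /evZ br_suml; apply: eq_bigr => t _; rewrite /evY br_sumr; apply: eq_bigr => u _.
  by rewrite gm_brZl gm_brZr evw_der // scalerA scaler_sumr.
rewrite IHa IHb gm_brDl !gm_brDr.
have -> : gm_br (evY (v ord0) Ya) (evY (v ord0) Yb) = 0.
  rewrite /evY br_suml big1 // => t _; rewrite br_sumr big1 // => u _.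
  by rewrite gm_brZl gm_brZr yc !scaler0.
rewrite add0r {3}/evY big_nil add0r !evZ_cat addrC [X in X + _]addrC -addrA.
rewrite (brC (evY _ _)) !dE; congr (_ + (_ + _)).
- rewrite /evZ br_suml big_flatten big_map; apply: eq_bigr => t _.
  rewrite big_flatten big_map br_sumr; apply: eq_bigr => u _.
  rewrite big_map gm_brZl gm_brZr evw_br /evZ scalerA scaler_sumr.
  by apply: eq_bigr => w _; rewrite scalerA.
- rewrite /evZ big_flatten big_map; apply: eq_bigr => t _.
  rewrite big_flatten big_map; apply: eq_bigr => u _.
  by rewrite big_map.
- rewrite /evZ big_flatten big_map -sumrN; apply: eq_bigr => t _.
  rewrite big_flatten big_map -sumrN; apply: eq_bigr => u _.
  by rewrite big_map -sumrN; apply: eq_bigr => w _; rewrite scaleNr.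
Qed.

End NormalForm.

(** * Multilinear elements *)

Section LeftNormed.
Variables (F : fieldType) (N : nat) (M : gmodel F N).
Local Open Scope ring_scope.

Definition lnorm (s : seq M) : M := if s is a :: s' then foldl (@gm_br F N M) a s' else 0.

Lemma lnorm_eq0 (s t : seq M) : lnorm s = 0 -> s != [::] -> lnorm (s ++ t) = 0.
Proof.
case: s => //= a s e _; rewrite foldl_cat e.
by elim: t => //= b t; rewrite br0l.
Qed.

Lemma evw_lnorm (L : eqType) (X : L -> M) Y w : evw X Y w = lnorm [seq evl X Y l | l <- w].
Proof. by case: w => //= l w; rewrite /evfrom; elim: w (evl _ _ _) => /=. Qed.

Definition vanish (L : eqType) (deg : L -> 'I_N) (Z : seq (F * seq (L * seq nat))) :=
  forall (X : L -> M) (Y : nat -> M), (forall l, gm_gr (lift ord0 (deg l)) (X l)) ->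
    (forall i, gm_gr ord0 (Y i)) -> evZ X Y Z = 0.

Definition comm0 := forall a b : M, gm_gr ord0 a -> gm_gr ord0 b -> gm_br a b = 0.

Lemma comm0_ycomm (Y : nat -> M) : comm0 -> (forall i, gm_gr ord0 (Y i)) -> ycomm Y.
Proof. by move=> c0 gY i j; apply: c0. Qed.

End LeftNormed.

Section Multilinear.
Variables (F : fieldType) (N : nat) (d : nat) (h : 'I_d -> 'I_N).
Local Notation E := (LExpr F N.+1).
Local Notation vec := {ffun 'I_d -> nat}.
Local Notation shape := (d.-tuple 'I_d).
Local Notation fpoly := (seq (F * (shape * seq vec))).
Local Notation word := (seq ('I_d * seq nat)).
Local Open Scope ring_scope.

(** Exponents are transposed: the [i]-th vector of [u] records how often each letter is bracketed
    with [y_i]. Renaming the [y_i] increasingly thus embeds one list of vectors into another, the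
    setting of Higman's lemma. *)
Definition mword (p : seq 'I_d) (u : seq vec) : word :=
  [seq (j, [seq c j | c : vec <- u]) | j <- p].

Definition mono_eval (M : gmodel F N) (th : shape -> seq vec -> M) :=
  exists X Y, [/\ forall j, gm_gr (lift ord0 (h j)) (X j), forall i, gm_gr ord0 (Y i)
    & th = fun (p : shape) u => evw X Y (mword p u)].

(** The renaming of the [y_i] that belongs to [pi]: it skips the positions at which [pi] inserts a
    vector. *)
Fixpoint sel (T : Type) (pi : seq (bool * vec)) (y : nat -> T) : nat -> T :=
  match pi with
  | [::] => y
  | (true, _) :: pi' => fun i => if i is i'.+1 then sel pi' (fun k => y k.+1) i' else y 0%N
  | (false, _) :: pi' => sel pi' (fun k => y k.+1)
  end.

Lemma sel_all (T : Type) (P : T -> Prop) pi (y : nat -> T) :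
  (forall i, P (y i)) -> forall i, P (sel pi y i).
Proof. by elim: pi y => // [[[] v] pi IH] y Py /=; [case=> // i|]; apply: IH. Qed.

Lemma act_splice (M : gmodel F N) (Y : nat -> M) pi (u : seq vec) j x : ycomm Y ->
  size u = keeps pi ->
  act Y [seq c j | c : vec <- splice pi u] x =
  act (sel pi Y) [seq c j | c : vec <- u] (act Y [seq v.2 j | v : bool * vec <- pi] x).
Proof.
elim: pi Y u x => [|[[] v] pi IH] Y u x yc /=; first by move/size0nil->.
  case: u => //= a u [su]; rewrite -act_iter; last by move=> i; apply: yc.
  have ycS : ycomm (fun k => Y k.+1) by move=> k l; apply: yc.
  by rewrite -iterD -(IH _ _ _ ycS su) ffunE.
by move=> su; rewrite IH // => k l; apply: yc.
Qed.

(** Splicing comes from a graded substitution: all vectors of [pi], added or inserted, are absorbed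
    into the letters, and the old exponents act through the selected [y_i]. *)
Lemma mono_eval_closed (M : gmodel F N) : comm0 M -> splice_closed (@mono_eval M).
Proof.
move=> c0 th pi [X [Y [gX gY ->]]].
exists (fun (p : shape) u => evw (fun j => act Y [seq v.2 j | v : bool * vec <- pi] (X j)) (sel pi Y) (mword p u)).
  exists (fun j => act Y [seq v.2 j | v : bool * vec <- pi] (X j)), (sel pi Y).
  split=> // [j|]; first exact: act_graded.
  exact: sel_all.
move=> p u su; rewrite !evw_lnorm /mword -!map_comp; congr lnorm.
by apply: eq_map => j; rewrite /= /evl /= act_splice //; apply: comm0_ycomm.
Qed.

Definition lnormE (s : seq E) : E := if s is a :: s' then foldl LBr a s' else LZero.

Fixpoint eact (es : seq nat) (k : nat) (e : E) : E :=
  if es is c :: es' then eact es' k.+1 (iter c (fun z => LBr z (LVar ord0 k)) e) else e.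

Definition eletter (l : 'I_d * seq nat) : E := eact l.2 0 (LVar (lift ord0 (h l.1)) l.1).

Definition epoly (g : fpoly) : E :=
  foldr (fun (t : F * (shape * seq vec)) acc => LAdd (LScale t.1 (lnormE [seq eletter l | l <- mword t.2.1 t.2.2])) acc)
    LZero g.

Lemma lev_lnormE (M : gmodel F N) (v : 'I_N.+1 -> nat -> M) s :
  lev v (lnormE s) = lnorm [seq lev v e | e <- s].
Proof. by case: s => //= a s; elim: s a => //= b s IH a; rewrite IH. Qed.

Lemma lev_eact (M : gmodel F N) (v : 'I_N.+1 -> nat -> M) es k e :
  lev v (eact es k e) = act (fun i => v ord0 (k + i)%N) es (lev v e).
Proof.
elim: es k e => //= c es IH k e; rewrite IH addn0.
have -> : (fun i => v ord0 (k.+1 + i)%N) = (fun i => v ord0 (k + i.+1)%N).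
  by apply/funext => i; rewrite addnS.
by congr act; elim: c => //= c ->.
Qed.

Lemma lev_epoly (M : gmodel F N) (v : 'I_N.+1 -> nat -> M) g :
  lev v (epoly g) =
  peval (fun (p : shape) u => evw (fun j : 'I_d => v (lift ord0 (h j)) j) (v ord0) (mword p u)) g.
Proof.
rewrite /peval; elim: g => [|t g IH] /=; first by rewrite big_nil.
rewrite big_cons IH lev_lnormE evw_lnorm -map_comp; congr (_ *: lnorm _ + _).
by apply: eq_map => l; rewrite /= lev_eact.
Qed.

Lemma sat_epoly (M : gmodel F N) g : sat M (epoly g) <-> pvanish (@mono_eval M) g.
Proof.
split=> [sg th [X [Y [gX gY ->]]]|vg v gv]; last first.
  rewrite lev_epoly; apply: vg.
  by exists (fun j : 'I_d => v (lift ord0 (h j)) j), (v ord0).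
(* The letters of [epoly] have distinct indices, so a single valuation realizes all of [X]; every
   other variable of nonzero degree goes to 0. *)
pose v (k : 'I_N.+1) i := if unlift ord0 k is Some k' then
  (if (insub i : option 'I_d) is Some j then (if h j == k' then X j else 0) else 0) else Y i.
have gv : graded_val v.
  move=> k i; rewrite /v; case: unliftP => [k' ->|-> //].
  case: insub => [j|]; last exact: gm_gr0.
  by case: eqP => [<-|_] //; apply: gm_gr0.
have := sg v gv; rewrite lev_epoly => e; rewrite -[RHS]e; congr peval.
apply/funext => p; apply/funext => u; congr (evw _ _ _).
  by apply/funext => j; rewrite /v liftK valK eqxx.
by apply/funext => i; rewrite /v unlift_none.
Qed.

(** The transposed exponents of [w], padded with zeros to [B] vectors; a section of [mword] when the
    letters are distinct. *)
Definition expo B (w : word) : seq vec :=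
  mkseq (fun i => [ffun j => nth 0%N (nth [::] (unzip2 w) (index j (unzip1 w))) i]) B.

Lemma evw_expo (M : gmodel F N) (X : 'I_d -> M) Y w B : uniq (unzip1 w) ->
  (forall l, l \in w -> (size l.2 <= B)%N) ->
  evw X Y (mword (unzip1 w) (expo B w)) = evw X Y w.
Proof.
move=> uw wB; rewrite !evw_lnorm /mword -!map_comp; congr lnorm.
apply/eq_in_map => l lw; rewrite /= /evl /=.
have -> : [seq c l.1 | c : vec <- expo B w] = l.2 ++ nseq (B - size l.2) 0%N.
  rewrite /expo /mkseq -map_comp.
  apply: (@eq_from_nth _ 0%N).
    by rewrite size_map size_iota size_cat size_nseq subnKC // wB.
  move=> i; rewrite size_map size_iota => iB.
  rewrite (nth_map 0%N) ?size_iota // nth_iota //= ffunE add0n.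
  have kw : (index l w < size w)%N by rewrite index_mem.
  have -> : index l.1 (unzip1 w) = index l w.
    rewrite -{1}(nth_index l lw) -(nth_map l l.1 fst kw) index_uniq //.
    by rewrite size_map.
  rewrite (nth_map l) // nth_index // nth_cat; case: ltnP => // li.
  by rewrite nth_nseq if_same nth_default.
by rewrite act_pad.
Qed.

(** The evaluations in [M] and in [M'] are two splice-closed families, compared through one finite
    Groebner basis. *)
Lemma multilinear_finite_basis (M : gmodel F N) : comm0 M ->
  exists G : seq fpoly, (forall g, g \in G -> sat M (epoly g)) /\
    forall M' : gmodel F N, comm0 M' -> (forall g, g \in G -> sat M' (epoly g)) ->
      forall Z : seq (F * word),
        (forall t, t \in Z -> uniq (unzip1 t.2) /\ size t.2 = d) ->
        vanish M h Z -> vanish M' h Z.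
Proof.
move=> c0; have [G [GM GP]] := finite_groebner_basis (mono_eval_closed c0).
exists G; split=> [g /GM|M' c0' GM' Z ZP vZ]; first by rewrite sat_epoly.
(* A common length, since only monomials with equally many vectors are comparable. *)
pose B := \max_(t <- Z) \max_(l <- t.2) size l.2.
(* The default [ord_tuple d] is never taken, as every word of [Z] has length [d]. *)
pose f : fpoly := [seq (t.1, (insubd (ord_tuple d) (unzip1 t.2), expo B t.2)) | t <- Z].
have fE (M0 : gmodel F N) X (Y : nat -> M0) :
    peval (fun (p : shape) u => evw X Y (mword p u)) f = evZ X Y Z.
  rewrite /peval big_map; apply: eq_big_seq => t tZ /=; congr (_ *: _).
  have [ut st] := ZP t tZ; rewrite insubdK ?evw_expo // => [l lt|].
    have lB : (size l.2 <= \max_(k <- t.2) size k.2)%N.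
      exact: (@leq_bigmax_seq _ _ xpredT (fun k : 'I_d * seq nat => size k.2) _ lt).
    apply: leq_trans lB _.
    exact: (@leq_bigmax_seq _ _ xpredT (fun t : F * word => \max_(k <- t.2) size k.2) _ tZ).
  by rewrite /in_mem /= size_map st eqxx.
have hf : homogp B f by move=> t /mapP[t' _ ->] /=; rewrite size_mkseq.
have vf : pvanish (@mono_eval M) f.
  by move=> th [X [Y [gX gY ->]]]; rewrite fE vZ.
have vf' : pvanish (@mono_eval M') f.
  apply: (GP _ _ (mono_eval_closed c0') _ _ _ hf vf) => g /GM'.
  by rewrite sat_epoly.
move=> X Y gX gY; rewrite -fE; apply: vf'; by exists X, Y.
Qed.

End Multilinear.

(** * Polarization *)

Section Expansion.
Variables (F : fieldType) (N d : nat) (L : finType).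
Local Open Scope ring_scope.
Local Notation wordL := (seq (L * seq nat)).
Local Notation wordI := (seq ('I_d * seq nat)).
Implicit Types (tau : {ffun 'I_d -> L}) (w : wordL).

(** The words that appear when each letter [l] is replaced by the sum of the new letters in its
    fibre under [tau]. *)
Fixpoint expand tau w : seq wordI :=
  if w is l :: w' then
    [seq (j, l.2) :: u | j <- [seq j <- enum 'I_d | tau j == l.1], u <- expand tau w']
  else [:: [::]].

Definition polar_val (M : gmodel F N) tau (X : 'I_d -> M) (l : L) : M :=
  \sum_(j | tau j == l) X j.

Lemma evfrom_expand (M : gmodel F N) tau (X : 'I_d -> M) Y a w :
  evfrom (polar_val tau X) Y a w = \sum_(u <- expand tau w) evfrom X Y a u.
Proof.
elim: w a => [|l w IH] a /=; first by rewrite big_seq1.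
rewrite big_allpairs_dep big_filter big_enum_cond /= /evl /polar_val act_sum br_sumr evfrom_sum.
by apply: eq_bigr => j _; rewrite IH.
Qed.

Lemma evw_expand (M : gmodel F N) tau (X : 'I_d -> M) Y w :
  evw (polar_val tau X) Y w = \sum_(u <- expand tau w) evw X Y u.
Proof.
case: w => [|l w] /=; first by rewrite big_seq1.
rewrite big_allpairs_dep big_filter big_enum_cond /= /evl /polar_val act_sum evfrom_sum.
by apply: eq_bigr => j _; rewrite evfrom_expand.
Qed.

Lemma expand_relabel tau w u : u \in expand tau w -> [seq (tau l.1, l.2) | l <- u] = w.
Proof.
elim: w u => [|l w IH] u /=; first by rewrite inE => /eqP->.
move=> /allpairsP[[j u'] /= [+ /IH e ->]]; rewrite mem_filter => /andP[/eqP tj _] /=.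
by rewrite e tj -surjective_pairing.
Qed.

(** Restitution: identifying the new letters along [tau] turns every expanded word back into [w]. *)
Lemma evw_relabel (M : gmodel F N) tau (X : L -> M) Y w u : u \in expand tau w ->
  evw (X \o tau) Y u = evw X Y w.
Proof.
by move=> /expand_relabel <-; rewrite !evw_lnorm -map_comp; congr lnorm; apply: eq_map.
Qed.

Fixpoint all_seqs (m : nat) : seq (seq 'I_d) :=
  if m is m'.+1 then [seq j :: p | j <- enum 'I_d, p <- all_seqs m'] else [:: [::]].

Lemma mem_all_seqs m p : (p \in all_seqs m) = (size p == m).
Proof.
elim: m p => [|m IH] [|j p] //=.
  by apply/allpairsP => -[[]] j p [].
rewrite eqSS -IH; apply/allpairsP/idP => [[[k q] /= [_ qm [_ ->]]] //|pm].
by exists (j, p); rewrite mem_enum.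
Qed.

Lemma uniq_all_seqs m : uniq (all_seqs m).
Proof.
elim: m => //= m IH; apply: allpairs_uniq => //; first exact: enum_uniq.
by move=> [j p] [k q] _ _ /= [-> ->].
Qed.

Lemma sum_expand (G : seq 'I_d -> nat) tau w :
  (\sum_(u <- expand tau w) G (unzip1 u) =
   \sum_(p <- all_seqs (size w) | map tau p == unzip1 w) G p)%N.
Proof.
elim: w G => [|l w IH] G /=.
  by rewrite big_seq1 big_mkcond big_seq1 eqxx.
rewrite big_allpairs_dep big_filter big_mkcond /= [RHS]big_mkcond big_allpairs_dep /=.
apply: eq_bigr => j _; rewrite (IH (fun p => G (j :: p))).
case: eqP => [tj|tj]; last first.
  by rewrite big1_seq // => p _; rewrite eqseq_cons; case: eqP.
by rewrite big_mkcond; apply: eq_bigr => p _; rewrite eqseq_cons tj eqxx.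
Qed.

Lemma count_uniq_all_seqs : count uniq (all_seqs d) = d`!.
Proof.
have := card_uniq_tuples d (pred_of_simpl (@predT 'I_d)).
rewrite cardT size_enum_ord ffactnn => <-.
rewrite cardE -(size_map val) -size_filter; apply: perm_size; apply: uniq_perm.
- exact: filter_uniq (uniq_all_seqs d).
- by rewrite map_inj_uniq ?enum_uniq //; apply: val_inj.
move=> p; rewrite mem_filter mem_all_seqs; apply/andP/mapP => [[up /eqP sp]|[t]].
  have spb : size p == d by apply/eqP.
  by exists (Tuple spb) => //; rewrite mem_enum inE /= up andbT; apply/allP.
by rewrite mem_enum inE => /andP[_ ut] ->; rewrite size_tuple.
Qed.

Lemma uniq_full (p : seq 'I_d) : uniq p -> size p = d -> forall j, j \in p.
Proof.
move=> up sp j; have [||_ ->] := @uniq_min_size _ p (enum 'I_d) up; last by rewrite mem_enum.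
  by move=> k _; rewrite mem_enum.
by rewrite size_enum_ord sp.
Qed.

(** Every index occurs exactly once in [p], so the values of [tau] can be read off from [ls]. *)
Lemma card_labelling (p : seq 'I_d) (ls : seq L) : (0 < d)%N -> uniq p -> size p = d ->
  size ls = d -> #|[pred tau : {ffun 'I_d -> L} | map tau p == ls]| = 1%N.
Proof.
move=> d0 up sp sl; have pf := uniq_full up sp.
case: ls sl => [|l0 ls' ] sl; first by rewrite -sl in d0.
move: (l0 :: ls') sl => {ls'} ls sl.
apply: (@eq_card1 _ [ffun j => nth l0 ls (index j p)]) => tau; rewrite !inE.
apply/eqP/eqP => [e|->].
  by apply/ffunP => j; rewrite ffunE -e (nth_map j) ?index_mem // nth_index.
apply: (@eq_from_nth _ l0); first by rewrite size_map sp.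
move=> i; rewrite size_map sp => id.
have j0 : 'I_d := Ordinal d0.
by rewrite (nth_map j0) ?sp // ffunE index_uniq ?sp.
Qed.

Definition full (u : wordI) := all (mem (unzip1 u)) (enum 'I_d).

Lemma size_expand tau w u : u \in expand tau w -> size u = size w.
Proof. by move=> /expand_relabel <-; rewrite size_map. Qed.

Lemma full_uniq u : full u -> (size u <= d)%N -> uniq (unzip1 u) /\ size u = d.
Proof.
move=> /allP fu su; have sub : {subset enum 'I_d <= unzip1 u} by move=> j /fu.
have le : (size (unzip1 u) <= size (enum 'I_d))%N by rewrite size_map size_enum_ord.
have uu := leq_size_uniq (enum_uniq _) sub le; split=> //.
apply/eqP; rewrite eqn_leq su /= -(size_map fst u) -[X in (X <= _)%N]size_enum_ord.
exact: uniq_leq_size (enum_uniq _) sub.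
Qed.

(** Exchange the sums. In length [d] each of the [d!] permutations of the indices arises from
    exactly one [tau]; a shorter word cannot contain all [d] indices. *)
Lemma full_count w : (0 < d)%N -> (size w <= d)%N ->
  (\sum_tau count full (expand tau w) = if size w == d then d`! else 0)%N.
Proof.
move=> d0 sw.
pose G (p : seq 'I_d) : nat := all (mem p) (enum 'I_d).
have GE tau : count full (expand tau w) =
    (\sum_(p <- all_seqs (size w) | map tau p == unzip1 w) G p)%N.
  by rewrite -sum_expand -sum1_count big_mkcond; apply: eq_bigr => u _; rewrite /G /full; case: all.
under eq_bigr do rewrite GE.
case: eqP => [sd|/eqP sd]; last first.
  rewrite big1 // => tau _; rewrite big1_seq // => p /andP[_]; rewrite mem_all_seqs => /eqP sp.
  rewrite /G; case: allP => // fp; case/negP: sd; rewrite eqn_leq sw -sp -[X in (X <= _)%N]size_enum_ord.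
  by apply: uniq_leq_size (enum_uniq _) _ => j /fp.
rewrite sd -count_uniq_all_seqs -sum1_count.
under eq_bigr do rewrite big_mkcond.
rewrite exchange_big [RHS]big_mkcond /=; apply: eq_big_seq => p; rewrite mem_all_seqs => /eqP sp.
have Gp : G p = uniq p.
  rewrite /G; congr nat_of_bool; apply/allP/idP => [fp|up j _]; last exact: uniq_full.
  by apply: leq_size_uniq (enum_uniq _) _ _ => [j /fp //|]; rewrite size_enum_ord sp.
rewrite Gp; case up: (uniq p); last by rewrite big1 // => tau _; rewrite if_same.
rewrite -big_mkcond sum1_card; apply: card_labelling => //.
by rewrite size_map.
Qed.

End Expansion.

Section Polarization.
Variables (F : fieldType) (N : nat).
Local Open Scope ring_scope.

Lemma lnorm_mem0 (M : gmodel F N) (s : seq M) : 0 \in s -> lnorm s = 0.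
Proof.
have foldl0 (t : seq M) : foldl (@gm_br F N M) 0 t = 0.
  by elim: t => //= b t; rewrite br0l.
case: s => //= a s; rewrite inE => /orP[/eqP<-|]; first exact: foldl0.
elim: s a => //= b s IH a; rewrite inE => /orP[/eqP<-|/IH //].
by rewrite br0r foldl0.
Qed.

(* Setting the [j]-th variable to 0 kills exactly the words containing [j]. *)
Lemma vanish_filter (M : gmodel F N) d (h : 'I_d -> 'I_N) Z j : vanish M h Z ->
  vanish M h [seq t <- Z | j \in unzip1 t.2].
Proof.
move=> vZ X Y gX gY.
pose X' k := if k == j then 0 else X k.
have gX' k : gm_gr (lift ord0 (h k)) (X' k).
  by rewrite /X'; case: eqP => // _; apply: gm_gr0.
have e : evZ X Y Z = evZ X Y [seq t <- Z | j \in unzip1 t.2] + evZ X' Y Z.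
  rewrite /evZ big_filter (bigID (fun t => j \in unzip1 t.2)) /=; congr (_ + _).
  rewrite [RHS](bigID (fun t => j \in unzip1 t.2)) /= [X in _ = X + _]big1 ?add0r => [|t jt].
    apply: eq_bigr => t jt; congr (_ *: _); rewrite !evw_lnorm; congr lnorm.
    apply/eq_in_map => l lt; rewrite /evl /X'; case: eqP => // lj.
    by case/negP: jt; rewrite -lj; apply: map_f.
  rewrite evw_lnorm lnorm_mem0 ?scaler0 //.
  case/mapP: jt => l lt jE; apply/mapP; exists l => //.
  by rewrite /evl /X' jE eqxx act0.
by move: e; rewrite !vZ // addr0.
Qed.

Lemma vanish_full (M : gmodel F N) d (h : 'I_d -> 'I_N) Z : vanish M h Z ->
  vanish M h [seq t <- Z | full t.2].
Proof.
move=> vZ; rewrite /full; elim: (enum 'I_d) => [|j s IH] /=; first by rewrite filter_predT.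
by rewrite filter_predI; apply: vanish_filter.
Qed.

Variables (L : finType) (deg : L -> 'I_N).
Local Notation word := (seq (L * seq nat)).

(** For words of length at most [d], those kept by [full] are exactly the multilinear ones. *)
Definition polarize d (tau : {ffun 'I_d -> L}) (Z : seq (F * word)) :=
  [seq t <- flatten [seq [seq (t.1, u) | u <- expand tau t.2] | t <- Z] | full t.2].

Lemma vanish_polarize (M : gmodel F N) d (tau : {ffun 'I_d -> L}) Z :
  vanish M deg Z -> vanish M (deg \o tau) (polarize tau Z).
Proof.
move=> vZ; apply: vanish_full => X Y gX gY.
rewrite -[RHS](vZ (polar_val tau X) Y) // => [|l].
  rewrite /evZ big_flatten big_map; apply: eq_bigr => t _.
  by rewrite big_map evw_expand scaler_sumr.
rewrite /polar_val; elim/big_rec: _ => [|j x /eqP <- gx]; first exact: gm_gr0.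
by apply: gm_grD => //; apply: gX.
Qed.

(** Restituting the polarizations and summing over all [tau] multiplies words of length [d] by [d!]
    and kills shorter ones, by [full_count]; then divide by [d!]. *)
Lemma restitution (M : gmodel F N) d (Z : seq (F * word)) :
  (0 < d)%N -> d`!%:R != 0 :> F -> (forall t, t \in Z -> (size t.2 <= d)%N) ->
  (forall tau : {ffun 'I_d -> L}, vanish M (deg \o tau) (polarize tau Z)) ->
  vanish M deg [seq t <- Z | size t.2 == d].
Proof.
move=> d0 df sZ vP X Y gX gY; apply: (scalerI df); rewrite scaler0.
have pE (tau : {ffun 'I_d -> L}) : evZ (X \o tau) Y (polarize tau Z) =
    \sum_(t <- Z) t.1 *: evw X Y t.2 *+ count (@full d) (expand tau t.2).
  rewrite /evZ big_filter big_flatten big_map; apply: eq_bigr => t _.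
  rewrite big_map /= -scaler_sumr scalerMnr; congr (_ *: _).
  rewrite -sum1_count -sumrMnr [RHS]big_seq_cond [LHS]big_seq_cond.
  by apply: eq_bigr => u /andP[ut _]; rewrite (evw_relabel X Y ut).
transitivity (\sum_(tau : {ffun 'I_d -> L}) evZ (X \o tau) Y (polarize tau Z)); last first.
  by rewrite big1 // => tau _; apply: vP => // j; apply: gX.
under [RHS]eq_bigr do rewrite pE.
rewrite exchange_big /= /evZ big_filter big_mkcond scaler_sumr; apply: eq_big_seq => t tZ.
rewrite sumrMnr full_count ?sZ //.
by case: eqP => _; rewrite ?mulr0n ?scaler0 // scaler_nat.
Qed.

(** Induction on the maximal length. By restitution the longest words vanish on their own in [M],
    and also in [M'] once their multilinear polarizations are transferred; what remains is shorter
    and still vanishes in [M]. *)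
Lemma transfer (M M' : gmodel F N) :
  (forall d, (d <= N)%N -> d`!%:R != 0 :> F) ->
  (forall d (h : 'I_d -> 'I_N) (Z : seq (F * seq ('I_d * seq nat))), (d <= N)%N ->
    (forall t, t \in Z -> uniq (unzip1 t.2) /\ size t.2 = d) ->
    vanish M h Z -> vanish M' h Z) ->
  forall d (Z : seq (F * word)), (d <= N)%N -> (forall t, t \in Z -> (size t.2 <= d)%N) ->
    vanish M deg Z -> vanish M' deg Z.
Proof.
move=> df TR; elim=> [|d IH] Z dN sZ vZ.
  move=> X Y _ _; rewrite /evZ big1_seq // => t /andP[_ /sZ].
  by rewrite leqn0 => /eqP/size0nil->; rewrite scaler0.
have ZE (M0 : gmodel F N) X (Y : nat -> M0) :
    evZ X Y Z = evZ X Y [seq t <- Z | size t.2 == d.+1] + evZ X Y [seq t <- Z | size t.2 != d.+1].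
  by rewrite /evZ !big_filter (bigID (fun t => size t.2 == d.+1)).
have vP tau := vanish_polarize (d := d.+1) (tau := tau) vZ.
have vd := restitution (ltn0Sn d) (df _ dN) sZ vP.
have vd' : vanish M' deg [seq t <- Z | size t.2 == d.+1].
  apply: (restitution _ (df _ dN) sZ) => // tau; apply: (TR _ _ _ dN) => // t.
  rewrite mem_filter => /andP[ft /flattenP[s /mapP[t' t'Z ->]]] /mapP[u ue tE].
  move: ft; rewrite tE /= => /full_uniq; apply.
  by rewrite (size_expand ue) sZ.
have vl : vanish M' deg [seq t <- Z | size t.2 != d.+1].
  apply: IH; first exact: ltnW.
    by move=> t; rewrite mem_filter => /andP[ne /sZ]; rewrite leq_eqVlt (negbTE ne).
  by move=> X Y gX gY; have := ZE _ X Y; rewrite vZ // vd // add0r => <-.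
by move=> X Y gX gY; rewrite ZE vd' // vl // addr0.
Qed.

End Polarization.

(** * Identities of upper triangular matrices *)

Section BasicIdentities.
Variables (F : fieldType) (N : nat).
Local Notation E := (LExpr F N.+1).
Local Open Scope ring_scope.

Program Definition ut_model : gmodel F N :=
  @GModel F N 'M[F]_N.+1 (@lie_br F N.+1) (fun g => @in_UT_comp F N.+1 g) _ _ _ _ _ _ _ _ _.
Next Obligation. by rewrite /lie_br mulmxDl mulmxDr opprD addrACA. Qed.
Next Obligation. by rewrite /lie_br mulmxDl mulmxDr opprD addrACA. Qed.
Next Obligation. by rewrite /lie_br -scalemxAl -scalemxAr scalerBr. Qed.
Next Obligation. by rewrite /lie_br -scalemxAl -scalemxAr scalerBr. Qed.
Next Obligation. by rewrite /lie_br subrr. Qed.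
Next Obligation.
rewrite /lie_br !mulmxBl !mulmxBr !mulmxA.
move: (x *m y *m z) (x *m z *m y) (y *m z *m x) (z *m y *m x) (y *m x *m z) (z *m x *m y).
move=> a b c d f g; rewrite !opprB [g - d + _]addrC [c - f + _ + _]addrACA !subrKA.
by rewrite [c - a + _]addrC addrACA !subrKA subrr.
Qed.
Next Obligation. by move=> i j; rewrite mxE eqxx. Qed.
Next Obligation.
move=> i j; rewrite mxE => xy; have [x0|/H //] := eqVneq (x i j) 0.
by apply: H0; rewrite x0 add0r in xy.
Qed.
Next Obligation.
move=> i j; rewrite !mxE => nz; apply/eqP; apply: contraNT nz => ne.
rewrite [X in X - _]big1 ?[X in _ - X]big1 ?subr0 // => k _; apply/eqP; rewrite mulf_eq0.
  have [//|/H0 /= ki] := eqVneq (y i k) 0; have [//|/H kj] := eqVneq (x k j) 0.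
  by case/negP: ne; rewrite kj ki addn0.
have [//|/H /= ki] := eqVneq (x i k) 0; have [//|/H0 kj] := eqVneq (y k j) 0.
by case/negP: ne; rewrite kj ki addn0.
Qed.

Lemma sat_ut_model e : sat ut_model e -> UT_graded_ids e.
Proof.
move=> se s gs; rewrite -[RHS](se s gs).
by elim: e {se} => //= [a -> b ->|c a ->|a -> b ->].
Qed.

Definition commE : E := LBr (LVar ord0 0) (LVar ord0 1).

Lemma sat_commE (M : gmodel F N) : sat M commE -> comm0 M.
Proof.
move=> sc a b ga gb.
pose v (g : 'I_N.+1) i : M := if g == ord0 then (if i == 0%N then a else b) else 0.
have /sc : graded_val v; last by rewrite /= /v eqxx.
move=> g i; rewrite /v; case: eqP => [->|_]; last exact: gm_gr0.
by case: ifP.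
Qed.

Lemma ut_commE : sat ut_model commE.
Proof.
have diagE (A : 'M[F]_N.+1) : in_UT_comp 0 A -> A = diag_mx (\row_i A i i).
  move=> gA; apply/matrixP => i j; rewrite !mxE.
  have [->|ne] := eqVneq i j; first by rewrite mulr1n.
  rewrite mulr0n; apply/eqP; apply: contraNT ne => /gA; rewrite addn0 => ji.
  by apply/eqP/val_inj.
move=> v gv /=; rewrite (diagE _ (gv ord0 0%N)) (diagE _ (gv ord0 1%N)).
by rewrite /lie_br diag_mxC subrr.
Qed.

(** The left-normed commutator of [N.+1] variables of degrees [t]. The exponent lists are empty,
    because letters with exponents are reached by substitution. *)
Definition nilE (t : {ffun 'I_N.+1 -> 'I_N}) : E :=
  epoly t [:: (1, (ord_tuple N.+1, [::]))].

Definition nilpotent (M : gmodel F N) := forall (L : eqType) (deg : L -> 'I_N) (X : L -> M) Y w,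
  (forall l, gm_gr (lift ord0 (deg l)) (X l)) -> (forall i, gm_gr ord0 (Y i)) ->
  (N < size w)%N -> evw X Y w = 0.

(** Whole letters, exponents included, are homogeneous and may replace the variables of [nilE]; this
    kills the first [N.+1] letters of [w], hence [w]. *)
Lemma sat_nilE (M : gmodel F N) : (forall t, sat M (nilE t)) -> nilpotent M.
Proof.
move=> sn L deg X Y w gX gY sw.
case: w sw => // l0 w'; move: (l0 :: w') => {w'} w sw.
pose t : {ffun 'I_N.+1 -> 'I_N} := [ffun j : 'I_N.+1 => deg (nth l0 w j).1].
pose x (j : 'I_N.+1) := evl X Y (nth l0 w j).
have x0 : lnorm [seq x j | j <- enum 'I_N.+1] = 0.
  have /sat_epoly/(_ (fun p u => evw x Y (mword p u))) := sn t.
  rewrite /peval big_seq1 scale1r evw_lnorm /mword -map_comp; apply.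
  by exists x, Y; split=> // j; rewrite ffunE; apply: act_graded.
have xE : [seq x j | j <- enum 'I_N.+1] = [seq evl X Y l | l <- take N.+1 w].
  by rewrite -(map_nth_iota0 l0 sw) -val_enum_ord -!map_comp.
rewrite evw_lnorm -(cat_take_drop N.+1 w) map_cat -xE; apply: lnorm_eq0 => //.
by rewrite -size_eq0 size_map size_enum_ord.
Qed.

(** Each further factor of nonzero degree moves the nonzero entries at least one more step above the
    diagonal, and a matrix of size [N.+1] has no room for [N.+1] steps. *)
Lemma ut_nilE t : sat ut_model (nilE t).
Proof.
apply/sat_epoly => th [X [Y [gX gY ->]]]; rewrite /peval big_seq1 scale1r evw_lnorm /mword -map_comp.
pose up k (A : 'M[F]_N.+1) := forall i j, A i j != 0 -> (i + k <= j)%N.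
have upX j : up 1%N (X j).
  by move=> i k /gX ->; rewrite lift0 leq_add2l.
have upbr k (A B : 'M[F]_N.+1) : up k A -> up 1%N B -> up k.+1 (lie_br A B).
  move=> uA uB i j; rewrite !mxE; apply: contraNT; rewrite -ltnNge => lt.
  rewrite [X in X - _]big1 ?[X in _ - X]big1 ?subr0 // => l _; apply/eqP; rewrite mulf_eq0.
    have [//|/uB il] := eqVneq (B i l) 0; have [//|/uA lj] := eqVneq (A l j) 0.
    by have := leq_trans (leq_add il (leqnn k)) lj; rewrite addn1 addSn -addnS leqNgt lt.
  have [//|/uA il] := eqVneq (A i l) 0; have [//|/uB lj] := eqVneq (B l j) 0.
  by have := leq_trans (leq_add il (leqnn 1)) lj; rewrite -addnA addn1 leqNgt lt.
have main s k (A : 'M[F]_N.+1) : up k A -> up (k + size s)%N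
    (foldl (@gm_br F N ut_model) A [seq X j | j : 'I_N.+1 <- s]).
  elim: s k A => [|j s IH] k A uA /=; first by rewrite addn0.
  by rewrite -addSnnS; apply: IH; apply: upbr.
have -> : [seq (evl X Y \o (fun j : 'I_N.+1 => (j, [seq c j | c : {ffun 'I_N.+1 -> nat} <- [::]]))) j
    | j <- ord_tuple N.+1] = [seq X j | j <- enum 'I_N.+1] by [].
have := size_enum_ord N.+1; case: (enum _) => //= j s [ss].
apply/matrixP => i k; rewrite mxE; apply/eqP; apply: contraT => nz.
have := main s 1%N _ (upX j) _ _ nz; rewrite ss add1n => le.
by have := leq_trans (leq_addl _ _) le; rewrite leqNgt ltn_ord.
Qed.

End BasicIdentities.

(** * Finite generation *)

Section Transfer.
Variables (F : fieldType) (N : nat).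
Local Notation E := (LExpr F N.+1).
Local Notation label := ('I_N * nat)%type.
Local Open Scope ring_scope.

Lemma evw_map (M : gmodel F N) (L L' : eqType) (f : L -> L') (X : L' -> M) Y w :
  evw X Y [seq (f l.1, l.2) | l <- w] = evw (X \o f) Y w.
Proof. by rewrite !evw_lnorm -map_comp. Qed.

Lemma evw_eq (M : gmodel F N) (L : eqType) (X X' : L -> M) Y w :
  (forall l, l \in w -> X l.1 = X' l.1) -> evw X Y w = evw X' Y w.
Proof.
move=> XX'; rewrite !evw_lnorm; congr lnorm; apply/eq_in_map => l lw.
by rewrite /evl XX'.
Qed.

(* Reduces the infinitely many labels to the finitely many that occur. *)
Lemma transfer_words (M M' : gmodel F N) :
  nilpotent M -> nilpotent M' ->
  (forall d, (d <= N)%N -> d`!%:R != 0 :> F) ->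
  (forall d (h : 'I_d -> 'I_N) (Z : seq (F * seq ('I_d * seq nat))), (d <= N)%N ->
    (forall t, t \in Z -> uniq (unzip1 t.2) /\ size t.2 = d) ->
    vanish M h Z -> vanish M' h Z) ->
  forall Z : seq (F * seq (label * seq nat)),
    vanish M (fun l : label => l.1) Z -> vanish M' (fun l : label => l.1) Z.
Proof.
move=> nM nM' df TR Z vZ.
pose Zs := [seq t <- Z | (size t.2 <= N)%N].
have ZsE (M0 : gmodel F N) (X : label -> M0) Y : nilpotent M0 ->
    (forall l, gm_gr (lift ord0 l.1) (X l)) -> (forall i, gm_gr ord0 (Y i)) ->
    evZ X Y Z = evZ X Y Zs.
  move=> n0 gX gY; rewrite /evZ big_filter [RHS]big_mkcond; apply: eq_bigr => t _.
  by case: leqP => // st; rewrite (n0 _ _ _ _ _ gX gY st) scaler0.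
(* [B] bounds the indices that occur, so [inord] is faithful on them. *)
pose B := \max_(t <- Zs) \max_(l <- t.2) l.1.2.
pose fin (l : label) : 'I_N * 'I_B.+1 := (l.1, inord l.2).
pose unfin (l : 'I_N * 'I_B.+1) : label := (l.1, l.2 : nat).
pose Z' := [seq (t.1, [seq (fin l.1, l.2) | l <- t.2]) | t <- Zs].
have Z'E (M0 : gmodel F N) X (Y : nat -> M0) : evZ X Y Z' = evZ (X \o fin) Y Zs.
  by rewrite /evZ big_map; apply: eq_bigr => t _; rewrite evw_map.
have vZ' : vanish M (fun l : 'I_N * 'I_B.+1 => l.1) Z'.
  by move=> X Y gX gY; rewrite Z'E -ZsE ?vZ // => l; exact: (gX (fin l)).
have {}vZ' : vanish M' (fun l : 'I_N * 'I_B.+1 => l.1) Z'.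
  apply: (transfer df TR (leqnn N)) vZ' => t /mapP[t' + ->].
  by rewrite mem_filter size_map => /andP[].
move=> X Y gX gY; rewrite ZsE // -[RHS](vZ' (X \o unfin) Y) // => [|l]; last exact: (gX (unfin l)).
rewrite Z'E /evZ; apply: eq_big_seq => t tZ; congr (_ *: _); apply: evw_eq => l lt /=.
rewrite /unfin /fin /= inordK -?surjective_pairing // ltnS.
have lB : (l.1.2 <= \max_(k <- t.2) k.1.2)%N.
  exact: (@leq_bigmax_seq _ _ xpredT (fun k : label * seq nat => k.1.2) _ lt).
apply: leq_trans lB _.
exact: (@leq_bigmax_seq _ _ xpredT
  (fun t : F * seq (label * seq nat) => \max_(k <- t.2) k.1.2)%N _ tZ).
Qed.

Lemma sum_grouped_eq0 (A : lmodType F) (s : seq (F * nat)) (Y : nat -> A) :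
  (forall i, \sum_(t <- s | t.2 == i) t.1 = 0) -> \sum_(t <- s) t.1 *: Y t.2 = 0.
Proof.
move=> s0; transitivity (\sum_(t <- s) \sum_(i <- undup (unzip2 s) | i == t.2) t.1 *: Y i).
  apply: eq_big_seq => t ts; rewrite -big_filter (filter_pred1_uniq (undup_uniq _)) ?big_seq1 //.
  by rewrite mem_undup; apply: map_f.
rewrite (exchange_big_dep xpredT) //= big1 // => i _.
under eq_bigl do rewrite eq_sym.
by rewrite -scaler_suml s0 scale0r.
Qed.

(** Sending one degree-0 variable to [a] and all others to 0 isolates its total coefficient. This
    scalar must be 0, a fact that no longer depends on the model. *)
Lemma evY_eq0 (M : gmodel F N) (a : M) e : comm0 M -> gm_gr ord0 a -> a != 0 -> sat M e ->
  forall (M' : gmodel F N) (Y : nat -> M'), evY Y (nf e).1 = 0.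
Proof.
move=> c0 ga a0 se M' Y; apply: sum_grouped_eq0 => i.
pose v (g : 'I_N.+1) k : M := if (g == ord0) && (k == i) then a else 0.
have gv : graded_val v.
  move=> g k; rewrite /v; case: ifP => [/andP[/eqP-> _] //|_]; exact: gm_gr0.
have := se v gv; rewrite lev_nf; last by apply: (comm0_ycomm c0) => k; apply: gv.
rewrite [X in _ + X]big1 ?addr0 => [|t _]; last first.
  rewrite evw_lnorm; case: t.2 => [|l w]; first by rewrite scaler0.
  rewrite lnorm_mem0 ?scaler0 //= inE /evl /zpart /v.
  by rewrite (eq_sym (lift _ _)) (negbTE (neq_lift _ _)) act0 eqxx.
rewrite /evY; under eq_bigr do rewrite /v eqxx /=.
move=> e0; apply/eqP; have : (\sum_(t <- (nf e).1 | t.2 == i) t.1) *: a == 0.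
  rewrite scaler_suml big_mkcond -[X in _ == X]e0; apply/eqP; apply: eq_bigr => t _.
  by case: eqP; rewrite ?scaler0.
by rewrite scaler_eq0 (negbTE a0) orbF.
Qed.

Lemma sat_transfer (M M' : gmodel F N) :
  comm0 M -> comm0 M' -> nilpotent M -> nilpotent M' ->
  (sat M (LVar ord0 0) -> sat M' (LVar ord0 0)) ->
  (forall d, (d <= N)%N -> d`!%:R != 0 :> F) ->
  (forall d (h : 'I_d -> 'I_N) (Z : seq (F * seq ('I_d * seq nat))), (d <= N)%N ->
    (forall t, t \in Z -> uniq (unzip1 t.2) /\ size t.2 = d) ->
    vanish M h Z -> vanish M' h Z) ->
  forall e, sat M e -> sat M' e.
Proof.
move=> c0 c0' nM nM' y0 df TR e se.
have satY (M0 : gmodel F N) (Y : nat -> M0) s : sat M0 (LVar ord0 0) ->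
    (forall i, gm_gr ord0 (Y i)) -> evY Y s = 0.
  move=> sy gY; rewrite /evY big1 // => t _.
  pose v (g : 'I_N.+1) (k : nat) : M0 := if g == ord0 then Y t.2 else 0.
  have /sy : graded_val v; last by rewrite /= /v eqxx => ->; rewrite scaler0.
  by move=> g k; rewrite /v; case: eqP => [->|_] //; apply: gm_gr0.
have [YM YM'] : (forall Y : nat -> M, (forall i, gm_gr ord0 (Y i)) -> evY Y (nf e).1 = 0) /\
    (forall Y : nat -> M', (forall i, gm_gr ord0 (Y i)) -> evY Y (nf e).1 = 0).
  (* Either the degree-0 part of [M] is zero, which [y0] passes on to [M'], or it contains some
     nonzero [a] and [evY_eq0] applies. *)
  have [sy|nsy] := pselect (sat M (LVar ord0 0)).
    by split=> Y gY; apply: satY => //; apply: y0.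
  have [a ga a0] : exists2 a : M, gm_gr ord0 a & a != 0.
    apply: contrapT => no; apply: nsy => v gv /=; apply/eqP; apply: contraT => nz.
    by case: no; exists (v ord0 0%N).
  by split=> Y _; apply: (evY_eq0 c0 ga a0 se).
have vZ : vanish M (fun l : label => l.1) (nf e).2.
  move=> X Y gX gY.
  pose v (g : 'I_N.+1) i : M := if unlift ord0 g is Some k then X (k, i) else Y i.
  have vY : v ord0 = Y by apply/funext => i; rewrite /v unlift_none.
  have vX : zpart v = X by apply/funext => -[k i]; rewrite /zpart /v liftK.
  have gv : graded_val v.
    move=> g i; rewrite /v; case: unliftP => [k ->|->] //; exact: (gX (k, i)).
  have := se v gv; rewrite lev_nf vY ?vX ?YM ?add0r //.
  exact: comm0_ycomm.
have vZ' := transfer_words nM nM' df TR vZ.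
move=> v gv; rewrite lev_nf; last by apply: (comm0_ycomm c0') => i; apply: gv.
rewrite YM' ?add0r => [|i]; last exact: gv.
by apply: vZ' => [l|i]; [exact: (gv (lift ord0 l.1) l.2) | apply: gv].
Qed.

Lemma all_inP (P : E -> Prop) (S : seq E) : all_in P S <-> forall e, e \in S -> P e.
Proof.
elim: S => //= e S IH; split=> [[Pe /IH PS] x|PS].
  by rewrite inE => /orP[/eqP->|/PS].
split; first by apply: PS; rewrite mem_head.
by apply/IH => x xS; apply: PS; rewrite inE xS orbT.
Qed.

End Transfer.

Local Open Scope ring_scope.

Theorem mainTheorem1 (F : fieldType) (n : nat) :
  (0 < n)%N ->
  (~ exists s : seq F, forall x : F, x \in s) ->
  ([pchar F] =i pred0 \/ exists2 p : nat, p \in [pchar F] & (n <= p)%N) ->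
  forall J : LExpr F n -> Prop,
    T_ideal J ->
    (forall f, UT_graded_ids f -> J f) ->
    T_fin_gen J.
Proof.
case: n => [//|N] _ _ charF J JT IJ.
(* All factors of [d!] are at most [N], hence smaller than a positive characteristic [p >= N.+1]. *)
have df d : (d <= N)%N -> d`!%:R != 0 :> F.
  elim: d => [|d IH] dN; first by rewrite fact0 oner_eq0.
  rewrite factS natrM mulf_neq0 ?IH ?(ltnW dN) //.
  case: charF => [/pcharf0P-> //|[p pF Np]].
  rewrite -(dvdn_pcharf pF); apply/negP => /(dvdn_leq (ltn0Sn _)).
  by rewrite leqNgt (leq_trans _ Np).
pose MJ := quot_model JT.
have JE e : sat MJ e <-> J e := sat_quot_model JT e.
have cJ : comm0 MJ by apply/sat_commE/JE/IJ/sat_ut_model/ut_commE.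
have nJ : nilpotent MJ by apply: sat_nilE => t; apply/JE/IJ/sat_ut_model/ut_nilE.
(* The degrees form a finite function, so that for each [d] they can be enumerated in [SG]. *)
have /choice[G GP] (dh : {d : nat & {ffun 'I_d -> 'I_N}}) : exists S : seq (LExpr F N.+1),
    (forall e, e \in S -> J e) /\
    forall M' : gmodel F N, comm0 M' -> (forall e, e \in S -> sat M' e) ->
      forall Z : seq (F * seq ('I_(projT1 dh) * seq nat)),
        (forall t, t \in Z -> uniq (unzip1 t.2) /\ size t.2 = projT1 dh) ->
        vanish MJ (projT2 dh) Z -> vanish M' (projT2 dh) Z.
  have [G [GJ GP]] := multilinear_finite_basis (projT2 dh) cJ.
  exists [seq epoly (projT2 dh) g | g <- G]; split=> [e /mapP[g gG ->]|M' c' GM'].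
    exact/JE/GJ.
  by apply: GP => // g gG; apply: GM'; apply: map_f.
pose S0 : seq (LExpr F N.+1) := commE F N :: [seq nilE F t | t : {ffun 'I_N.+1 -> 'I_N}].
(* Accounts for the linear part of degree 0, which words do not see. *)
pose SY : seq (LExpr F N.+1) := if `[< J (LVar ord0 0) >] then [:: LVar ord0 0] else [::].
pose SG d := flatten [seq G (existT _ d h) | h : {ffun 'I_d -> 'I_N}].
exists (S0 ++ SY ++ flatten [seq SG d | d <- iota 0 N.+1]); split.
  apply/all_inP => e; rewrite mem_cat [e \in SY ++ _]mem_cat => /or3P[|eY|/flattenP[s /mapP[d _ ->]]].
  - rewrite inE => /orP[/eqP->|/imageP[t _ ->]]; apply/IJ/sat_ut_model; first exact: ut_commE.
    exact: ut_nilE.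
  - by move: eY; rewrite /SY; case: asboolP => // Jy; rewrite inE => /eqP->.
  - by move=> /flattenP[s' /imageP[h _ ->]]; apply: (GP _).1.
(* For any T-ideal [K] containing the generators, identities are transferred from the quotient by
   [J] to the quotient by [K]. *)
move=> K KT /all_inP SK a Ja.
pose MK := quot_model KT.
have KE e : sat MK e <-> K e := sat_quot_model KT e.
have cK : comm0 MK by apply/sat_commE/KE/SK; rewrite mem_cat mem_head.
have nK : nilpotent MK.
  apply: sat_nilE => t; apply/KE/SK; rewrite mem_cat inE.
  by rewrite (_ : nilE F t \in _) ?orbT //; apply: image_f.
apply/KE; apply: (sat_transfer cJ cK nJ nK _ df _ (proj2 (JE a) Ja)).
  move=> /JE Jy; apply/KE/SK; rewrite mem_cat [_ \in SY ++ _]mem_cat /SY.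
  by case: asboolP => // _; rewrite mem_head orbT.
move=> d h Z dN ZP vZ.
have hE : h = [ffun j => h j] :> ('I_d -> 'I_N) by apply/funext => j; rewrite ffunE.
rewrite hE in vZ *; apply: ((GP (existT _ d [ffun j => h j])).2 MK cK _ Z) => // e eG.
apply/KE/SK; rewrite mem_cat [e \in SY ++ _]mem_cat; apply/orP; right; apply/orP; right.
apply/flattenP; exists (SG d); first by apply: map_f; rewrite mem_iota.
by apply/flattenP; exists (G (existT _ d [ffun j => h j])) => //; apply: image_f.
Qed.
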